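(* Let $k\ge 2$ and let $g_0,\ldots,g_k$ be geodesics in the Poincaré unit disk carried by Euclidean circles $C_0,\dots,C_k$ bounding pairwise disjoint closed disks $D_0,\dots,D_k\subset\mathbb{C}$. Let $\Gamma=\Gamma_{g_0,\dots,g_k}$ be the group generated by the reflections in $g_0,\dots,g_k$ and let $\mu_\Gamma$ be its limit measure. For every (sufficiently small) $\epsilon>0$, let $$\mu_\Gamma^{(\epsilon)}=\sum_{l=0}^{M(\epsilon)} w_l^{(\epsilon)}\,\delta_{z_l^{(\epsilon)}}$$ be the atomic measure supported on the sample points $z_l^{(\epsilon)}\in S^1$ produced by McMullen's algorithm, with weights $w_l^{(\epsilon)}$ given by the normalized Perron–Frobenius eigenvector of $T^{d_\epsilon}$. Then the probability measures $\mu_\Gamma^{(\epsilon)}$ converge weakly to $\mu_\Gamma$ as $\epsilon\to 0$.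
   Context: Reflection groups. $\mathbb{D}$ is the Poincaré unit disk with hyperbolic distance $d(\cdot,\cdot)$, $S^1=\partial\mathbb{D}$. Each geodesic is $g_l=\mathbb{D}\cap C_l$ with $C_l=\partial D_l$ a Euclidean circle meeting $S^1$ orthogonally; $\rho_l$ is the Euclidean reflection (inversion) in $C_l$, which preserves $\mathbb{D}$ and $S^1$; $\Gamma=\langle\rho_0,\dots,\rho_k\rangle$. The limit set is $\Lambda_\infty(\Gamma)=\overline{\Gamma\cdot p}\cap S^1$ (independent of $p\in\mathbb{D}$). For $\gamma\in\Gamma$, $|\gamma'|$ denotes the absolute value of the derivative of $\gamma:S^1\to S^1$ with respect to angle. Limit measure. Let $\Gamma_0\subset\Gamma$ be the index-2 subgroup of orientation-preserving elements, and let $\delta(\Gamma)$ be the critical exponent of the series $\sum_{\gamma\in\Gamma_0}e^{-s\,d(x,\gamma y)}$ (convergent for $s>\delta(\Gamma)$, divergent for $s<\delta(\Gamma)$, independent of $x,y\in\mathbb{D}$); it equals $\dim_H\Lambda_\infty(\Gamma)$. The limit measure $\mu_\Gamma$ is the unique probability measure supported on $\Lambda_\infty(\Gamma)$ such that for all $\gamma\in\Gamma$ and all continuous $f:S^1\to\mathbb{C}$, $\int_{S^1} f\,d\mu_\Gamma=\int_{S^1} (f\circ\gamma)\,|\gamma'|^{\delta(\Gamma)}\,d\mu_\Gamma$. Cells. The cells of generation $0$ (primitive cells) are $D_0,\dots,D_k$. The cells of generation $1$ are $\rho_s(D_l)$, $s\ne l$. The cells of generation $n+1$ are obtained by reflecting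 all cells of generation $n$ in all primitive circles $C_s$ whose disk $D_s$ does not contain them. Every cell of generation $n\ge 1$ is contained in a unique cell of generation $n-1$ (its parent), and every cell of generation $n$ contains exactly $k$ cells of generation $n+1$ (its children). McMullen's algorithm. Fix $\epsilon>0$ (small). Start with the list of all cells of generation one. Repeatedly replace every cell in the list of radius at least $\epsilon$ by its $k$ children, keeping cells of radius less than $\epsilon$, until all cells in the list have radius less than $\epsilon$ (this terminates). Denote the final list by $P_0,\dots,P_M$, $M=M(\epsilon)$. Let $z_l=z_l^{(\epsilon)}\in S^1$ be the radial projection to $S^1$ of the Euclidean centre of $P_l$. For each $i$ let $p(i)$ be the index of the primitive cell $D_{p(i)}$ containing $P_i$. Write $i\mapsto j$ if $P_j\subset\rho_{p(i)}(P_i)$. Let $T$ be the $(M+1)\times(M+1)$ matrix with $T_{ij}=|\rho_{p(i)}'(\rho_{p(i)}(z_j))|^{-1}$ if $i\mapsto j$ and $T_{ij}=0$ otherwise. For $d>0$ let $T^d$ be the matrix obtained by raising each entry to the power $d$ (entrywise, with zero entries remaining $0$); it is a primitive non-negative matrix. Let $\lambda(\cdot)$ denote the spectral radius, and let $d_\epsilon$ be the unique positive number with $\lambda(T^{d_\epsilon})=1$. Let $w^{(\epsilon)}=(w_0^{(\epsilon)},\dots,w_M^{(\epsilon)})$ be the Perron–Frobenius (right) eigenvector, $T^{d_\epsilon}w^{(\epsilon)}=w^{(\epsilon)}$, with positive entries normalized by $\sum_l w_l^{(\epsilon)}=1$. $\delta_z$ is the Dirac measure at $z$; weak convergence means convergence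 of integrals of all continuous functions on $S^1$. *)

(* Defs.v *)
From HB Require Import structures.
From mathcomp Require Import all_boot all_order all_algebra.
From mathcomp Require Import complex.
From mathcomp Require Import all_classical all_reals all_analysis.
Set Implicit Arguments.
Unset Strict Implicit.
Unset Printing Implicit Defensive.
Import Order.TTheory GRing.Theory Num.Theory.
Import numFieldNormedType.Exports.
Local Open Scope classical_set_scope.
Local Open Scope complex_scope.
Local Open Scope ring_scope.

(* R[i] gets its (Euclidean) topology as the regular module R[i]^o. *)
Notation Cplx R := (R[i]^o).

(* The complex plane with its Borel sigma-algebra; [set (borelC R)] is
   [set (Cplx R)]. *)
Notation borelC R := (g_sigma_algebraType (@open (Cplx R))).

Section Plane.
Variable R : realType.
Implicit Types (z : Cplx R) (gamma : Cplx R -> Cplx R).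

Definition modulus z : R := ComplexField.Normc.normc z.

(* A pair (c, r) stands for the Euclidean disk of centre c and radius r. *)
Definition cdisk (D : Cplx R * R) : set (Cplx R) :=
  [set z | modulus (z - D.1) <= D.2].

Definition circle (D : Cplx R * R) : set (Cplx R) :=
  [set z | modulus (z - D.1) = D.2].

Definition unit_disk : Cplx R * R := (0, 1).
Definition S1 : set (Cplx R) := circle unit_disk.
Definition poincare_disk : set (Cplx R) := [set z | modulus z < 1].

(* The two circles meet, and at every common point their radii (equivalently
   their tangents) are perpendicular. *)
Definition orthogonal_circles (D E : Cplx R * R) : Prop :=
  circle D `&` circle E !=set0 /\
  forall z, circle D z -> circle E z ->
    complex.Re ((z - D.1) * conjc (z - E.1)) = 0.

(* Since 0^-1 = 0, the centre is mapped to itself rather than to infinity, so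
   that the inversion is an involution of the whole plane. *)
Definition inversion (D : Cplx R * R) : Cplx R -> Cplx R :=
  fun z => D.1 + (D.2 ^+ 2)%:C / conjc (z - D.1).

Definition hdist (x y : Cplx R) : R :=
  let u := 1 + 2 * modulus (x - y) ^+ 2 /
               ((1 - modulus x ^+ 2) * (1 - modulus y ^+ 2)) in
  ln (u + Num.sqrt (u ^+ 2 - 1)).

Definition cis (t : R) : Cplx R := cos t +i* sin t.

(* |gamma'(z)| for gamma : S^1 -> S^1: if gamma(e^{i t}) = e^{i phi(t)}, then
   |phi'(t)| is the norm of the velocity of t |-> gamma(e^{i t}). *)
Definition circle_deriv gamma z : R :=
  let u := fun t : R => complex.Re (gamma (z * cis t)) in
  let v := fun t : R => complex.Im (gamma (z * cis t)) in
  Num.sqrt (derive1 u 0 ^+ 2 + derive1 v 0 ^+ 2).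

Definition jacobian gamma z : R :=
  let ux := derive1 (fun t : R => complex.Re (gamma (z + t%:C))) 0 in
  let uy := derive1 (fun t : R => complex.Re (gamma (z + t *i))) 0 in
  let vx := derive1 (fun t : R => complex.Im (gamma (z + t%:C))) 0 in
  let vy := derive1 (fun t : R => complex.Im (gamma (z + t *i))) 0 in
  ux * vy - uy * vx.

Definition orientation_preserving gamma : Prop :=
  forall z, poincare_disk z -> 0 < jacobian gamma z.

Definition radial_projection z : Cplx R := z / (modulus z)%:C.

Definition cintegral (mu : probability (borelC R) R) (f : Cplx R -> Cplx R) :
    Cplx R :=
  (\int[mu]_(z in S1) complex.Re (f z)) +i*
  (\int[mu]_(z in S1) complex.Im (f z)).

End Plane.

Arguments S1 R _ : clear implicits.

Section ReflectionGroup.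
Variables (R : realType) (k : nat) (D : 'I_k.+1 -> Cplx R * R).

Definition reflection (l : 'I_k.+1) : Cplx R -> Cplx R := inversion (D l).

Definition disjoint_geodesic_disks : Prop :=
  [/\ forall l, 0 < (D l).2,
      forall l, orthogonal_circles (D l) (unit_disk R) &
      trivIset [set: 'I_k.+1] (fun l => cdisk (D l))].

Inductive Gamma : (Cplx R -> Cplx R) -> Prop :=
| Gamma_id : Gamma id
| Gamma_gen l : Gamma (reflection l)
| Gamma_comp g h : Gamma g -> Gamma h -> Gamma (g \o h)
| Gamma_inv g h : Gamma g -> cancel g h -> cancel h g -> Gamma h.

Definition Gamma0 : set (Cplx R -> Cplx R) :=
  [set g | Gamma g /\ orientation_preserving g].

(* The limit set does not depend on the base point, taken here to be 0. *)
Definition limit_set : set (Cplx R) :=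
  closure [set g 0 | g in Gamma] `&` S1 R.

Definition poincare_series (s : R) (x y : Cplx R) : \bar R :=
  (\esum_(g in Gamma0) (expR (- s * hdist x (g y)))%:E)%E.

Definition is_critical_exponent (delta : R) : Prop :=
  forall x y, poincare_disk x -> poincare_disk y ->
    (forall s, delta < s -> (poincare_series s x y < +oo)%E) /\
    (forall s, s < delta -> poincare_series s x y = +oo%E).

(* Supported on the closed set limit_set, and conformal of dimension delta. *)
Definition is_limit_measure (mu : probability (borelC R) R) : Prop :=
  exists delta : R,
    [/\ is_critical_exponent delta,
        mu (~` limit_set) = 0%E &
        forall g, Gamma g ->
          forall f : Cplx R -> Cplx R, {within S1 R, continuous f} ->
            cintegral mu f =
            cintegral mu (fun z => f (g z) * (circle_deriv g z `^ delta)%:C)].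

(* The equation determines the centre and radius of P, the disks being
   nondegenerate. *)
Fixpoint cells (n : nat) : set (Cplx R * R) :=
  if n is n'.+1 then
    [set P | exists s Q, [/\ cells n' Q, ~ (cdisk Q `<=` cdisk (D s)) &
                             cdisk P = reflection s @` cdisk Q]]
  else range D.

Definition children (Q : Cplx R * R) : set (Cplx R * R) :=
  [set P | exists n, [/\ cells n Q, cells n.+1 P & cdisk P `<=` cdisk Q]].

Definition mcmullen_step (eps : R) (L : set (Cplx R * R)) :
    set (Cplx R * R) :=
  [set P | L P /\ P.2 < eps] `|`
  \bigcup_(Q in [set Q | L Q /\ eps <= Q.2]) children Q.

Definition mcmullen_list (eps : R) (M : nat) (P : 'I_M.+1 -> Cplx R * R) :
    Prop :=
  [/\ injective P,
      forall l, (P l).2 < eps &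
      exists n, range P = iter n (mcmullen_step eps) (cells 1)].

Definition sample_point (M : nat) (P : 'I_M.+1 -> Cplx R * R) (l : 'I_M.+1) :
    Cplx R :=
  radial_projection (P l).1.

Definition transition_matrix (M : nat) (P : 'I_M.+1 -> Cplx R * R)
    (p : 'I_M.+1 -> 'I_k.+1) : 'M[R]_M.+1 :=
  \matrix_(i, j)
    if `[< cdisk (P j) `<=` reflection (p i) @` cdisk (P i) >]
    then (circle_deriv (reflection (p i))
                       (reflection (p i) (sample_point P j)))^-1
    else 0.

Definition spectral_radius (n : nat) (A : 'M[R]_n) : R :=
  sup [set modulus l | l in
         [set l : R[i] | eigenvalue (map_mx (real_complex R) A) l]].

(* 0 `^ d = 0 for d > 0, so zero entries stay zero. *)
Definition entrywise_power (n : nat) (A : 'M[R]_n) (d : R) : 'M[R]_n :=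
  map_mx (fun t => t `^ d) A.

(* nu is the atomic measure \sum_l w_l \delta_{z_l} given by McMullen's
   algorithm with threshold eps. *)
Definition is_mcmullen_measure (eps : R) (nu : probability (borelC R) R) :
    Prop :=
  exists (M : nat) (P : 'I_M.+1 -> Cplx R * R) (p : 'I_M.+1 -> 'I_k.+1)
         (d : R) (w : 'cV[R]_M.+1),
    let Td := entrywise_power (transition_matrix P p) d in
    [/\ mcmullen_list eps P,
        forall i, cdisk (P i) `<=` cdisk (D (p i)),
        0 < d /\ spectral_radius Td = 1,
        [/\ Td *m w = w, forall l, 0 < w l 0 & \sum_l w l 0 = 1] &
        forall A : set (borelC R), measurable A ->
          nu A = (\sum_l (w l 0)%:E * \d_(sample_point P l : borelC R) A)%E].

End ReflectionGroup.

Definition weak_cvg_at_0 (R : realType) (mu_ : R -> probability (borelC R) R)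
    (mu : probability (borelC R) R) : Prop :=
  forall f : Cplx R -> Cplx R, {within S1 R, continuous f} ->
    cintegral (mu_ eps) f @[eps --> 0^'+] --> cintegral mu f.

(* Main.v *)
Require Import Defs.
From mathcomp Require Import all_boot all_order all_algebra.
From mathcomp Require Import complex.
From mathcomp Require Import all_classical all_reals all_analysis.
From mathcomp Require Import measurable_realfun.
From mathcomp Require Import ring lra.

(** Let t_i = |rho_i'| on S^1, and let L_d be the transfer operator
      (L_d g)(x) = sum over the i with x outside D_i of t_i(x)^d g(rho_i x),
    acting on functions on the arcs S^1 cap D_l.  Both measures of the theorem
    are tied to it.  Splitting a function over the disks D_i and moving the
    i-th piece by rho_i turns the conformality of mu into the invariance
    mu(L_delta g) = mu(g) ([limit_mean_transfer]).  The eigenvector equation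
    T^d w = w says that the atomic measure nu_eps satisfies
    nu_eps(L_d g) = nu_eps(g), except that g is evaluated at rho_s(z_j) on one
    side and at the sample point of the cell containing rho_s(z_j) on the other.
    These points are at most 2 eps apart, so for a function g whose logarithm is
    B-Lipschitz the two sides agree up to a factor exp(2 B eps)
    ([atomic_mean_almost_invariant]).  The combinatorial input is that for each
    P_j and each s with P_j outside D_s, exactly one listed cell in D_s contains
    rho_s(P_j) ([list_transition_exists]): the list is an antichain of cells
    that covers every cell of radius less than eps.

    It remains to see that an almost invariant mean is almost unique.  As the
    disks are disjoint, the rho_i contract the arcs D_l, l <> i, uniformly and
    log t_i is Lipschitz there, so L_delta maps each cone of positive functions
    with B-Lipschitz logarithm, B large, strictly inside itself.  As there are
    at least three disks, any arc is reached from any arc by a word of length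
    two, and L_delta^2 g has all its values comparable ([transfer2_harnack]).
    A coupling argument then shows that L_delta^n g - mu(g) L_delta^n 1 tends to
    0 uniformly ([transfer_mixing], [iter_transfer_asymptotics]).

    The exponents d = d_eps are controlled by the iterates L_delta^n 1, which
    lie between two positive constants.  Since t_i is bounded away from 0 and
    from 1 on the arcs, L_d^n 1 would decay or grow exponentially if |d - delta|
    were large compared to eps, against the almost invariance of nu_eps; hence
    |d - delta| = O(eps) ([exponent_gap]) and nu_eps is almost invariant under
    L_delta itself ([almost_invariant_unperturbed]).  For fixed large n and
    eps -> 0,
      nu_eps(g) ~ nu_eps(L_delta^n g) ~ mu(g) nu_eps(L_delta^n 1) ~ mu(g)
    ([atomic_mean_limit]).  Adding a constant brings any Lipschitz function into
    such a cone, and Lipschitz functions are dense among the continuous ones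
    ([lipschitz_S1_dense]). *)

Set Implicit Arguments.
Unset Strict Implicit.
Unset Printing Implicit Defensive.
Import Order.TTheory GRing.Theory Num.Theory.
Import numFieldNormedType.Exports.
Local Open Scope classical_set_scope.
Local Open Scope complex_scope.
Local Open Scope ring_scope.

(** * Transfer operators and their almost invariant means *)

Section TransferOperator.
Variables (R : realType) (I : finType) (E : Type).
Variables (dist : E -> E -> R) (X : I -> E -> Prop) (rho : I -> E -> E).

Definition transfer (a : I -> E -> R) (g : E -> R) (x : E) : R :=
  \sum_i a i x * g (rho i x).

(** For a = t^delta and s = - log t these are the weights t^(delta + h). *)
Definition tilted_weight (a s : I -> E -> R) (h : R) (i : I) (x : E) : R :=
  a i x * expR (- h * s i x).

(** Only pairs of points in the same piece X l are compared: the weights a i are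
    discontinuous from one piece to another. *)
Definition log_lip_cone (B : R) (g : E -> R) : Prop :=
  (forall l x, X l x -> 0 <= g x) /\
  (forall l x y, X l x -> X l y -> g x <= expR (B * dist x y) * g y).

(** A graph-directed system on the pieces X l in which every letter i may be
    applied to every piece but X i. *)
Record markov_system (a : I -> E -> R) (m M K theta : R) : Prop := MarkovSystem {
  ms_dist_ge0 : forall x y, 0 <= dist x y;
  ms_dist_le2 : forall l x y, X l x -> X l y -> dist x y <= 2;
  ms_diag : forall l x, X l x -> a l x = 0;
  ms_m_gt0 : 0 < m;
  ms_bounds : forall i l x, i != l -> X l x -> m <= a i x <= M;
  ms_distortion : forall i l x y, i != l -> X l x -> X l y ->
    a i x <= expR (K * dist x y) * a i y;
  ms_maps : forall i l x, i != l -> X l x -> X i (rho i x);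
  ms_contraction : forall i l x y, i != l -> X l x -> X l y ->
    dist (rho i x) (rho i y) <= theta * dist x y;
  ms_card : (2 < #|I|)%N }.

Definition markov_domain (x : E) : Prop := exists l, X l x.
Local Notation XX := markov_domain.

Lemma transfer_sub a f g x :
  transfer a (fun y => f y - g y) x = transfer a f x - transfer a g x.
Proof. by rewrite /transfer -sumrB; apply: eq_bigr => i _; rewrite mulrBr. Qed.

Lemma transfer_scale a c g x :
  transfer a (fun y => c * g y) x = c * transfer a g x.
Proof. by rewrite /transfer mulr_sumr; apply: eq_bigr => i _; rewrite mulrCA. Qed.

Lemma iter_transfer_sub a n f g :
  iter n (transfer a) (fun y => f y - g y) =
  (fun y => iter n (transfer a) f y - iter n (transfer a) g y).
Proof.
elim: n => [|n IH] //=; rewrite IH; apply/funext => x.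
by rewrite transfer_sub.
Qed.

Lemma iter_transfer_scale a n c g :
  iter n (transfer a) (fun y => c * g y) =
  (fun y => c * iter n (transfer a) g y).
Proof.
elim: n => [|n IH] //=; rewrite IH; apply/funext => x.
by rewrite transfer_scale.
Qed.

Section Contraction.
Variables (a : I -> E -> R) (m M K theta : R).
Hypothesis ms : markov_system a m M K theta.

Lemma ms_weight_ge0 i x : XX x -> 0 <= a i x.
Proof.
move=> [l Xx]; have [->|il] := eqVneq i l; first by rewrite (ms_diag ms Xx).
by have /andP[h _] := ms_bounds ms il Xx; apply: le_trans h; exact: ltW (ms_m_gt0 ms).
Qed.

(** Three letters make the system mix: any two can be avoided. *)
Lemma ms_other (l l' : I) : exists i, i != l /\ i != l'.
Proof.
have : (0 < #|~: [set l; l'] : {set I}|)%N.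
  rewrite lt0n; apply/eqP => e; have := ms_card ms.
  by rewrite -(cardsC [set l; l']) cards2 e; case: (l != l').
by case/card_gt0P => i; rewrite !inE negb_or => /andP[? ?]; exists i.
Qed.

Lemma ms_bound_ge : (exists x, XX x) -> m <= M.
Proof.
move=> [x [l Xx]]; have [i [il _]] := ms_other l l.
by have /andP[] := ms_bounds ms il Xx; exact: le_trans.
Qed.

Lemma transfer_ge0 g x : (forall y, XX y -> 0 <= g y) -> XX x ->
  0 <= transfer a g x.
Proof.
move=> g0 [l Xx]; apply: sumr_ge0 => i _.
have [->|il] := eqVneq i l; first by rewrite (ms_diag ms Xx) mul0r.
apply: mulr_ge0; first by apply: ms_weight_ge0; exists l.
by apply: g0; exists i; exact: (ms_maps ms il Xx).
Qed.

Lemma log_lip_cone_weaken (B B' : R) g : B <= B' -> log_lip_cone B g -> log_lip_cone B' g.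
Proof.
move=> BB [g0 gB]; split=> // l x y Xx Xy; apply: le_trans (gB _ _ _ Xx Xy) _.
apply: ler_wpM2r; first exact: g0 Xy.
by rewrite ler_expR ler_wpM2r ?(ms_dist_ge0 ms).
Qed.

(** The contraction of the maps improves the constant of g, and the distortion
    of the weights adds K. *)
Lemma log_lip_cone_transfer (B : R) g : 0 <= B -> log_lip_cone B g ->
  log_lip_cone (theta * B + K) (transfer a g).
Proof.
move=> B0 [g0 gB]; split=> [l x Xx|l x y Xx Xy].
  by apply: transfer_ge0; [move=> y [l' Xy]; exact: g0 Xy | exists l].
rewrite /transfer mulr_sumr; apply: ler_sum => i _.
have [->|il] := eqVneq i l; first by rewrite (ms_diag ms Xx) (ms_diag ms Xy) !mul0r mulr0.
rewrite mulrDl expRD.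
have Xix := ms_maps ms il Xx; have Xiy := ms_maps ms il Xy.
have h1 := ms_distortion ms il Xx Xy.
have h2 : g (rho i x) <= expR (theta * B * dist x y) * g (rho i y).
  apply: le_trans (gB _ _ _ Xix Xiy) _; apply: ler_wpM2r; first exact: g0 Xiy.
  rewrite ler_expR [theta * B]mulrC -mulrA ler_wpM2l //.
  exact: (ms_contraction ms il Xx Xy).
have -> : expR (theta * B * dist x y) * expR (K * dist x y) * (a i y * g (rho i y))
  = (expR (K * dist x y) * a i y) * (expR (theta * B * dist x y) * g (rho i y)) by ring.
apply: ler_pM => //; last exact: g0 Xix.
by apply: ms_weight_ge0; exists l.
Qed.

Definition harnack_constant (B : R) : R :=
  1 + #|I|%:R ^+ 2 * (M ^+ 2 * expR (2 * B) / m ^+ 2).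

Lemma harnack_constant_ge1 B : 1 <= harnack_constant B.
Proof.
by rewrite /harnack_constant lerDl; apply: mulr_ge0; rewrite ?sqr_ge0//
  divr_ge0 ?sqr_ge0// mulr_ge0 ?sqr_ge0 ?expR_ge0.
Qed.

(** In L (L g) x, the value of g at a point of X j is reached by a word i j with
    i different from j and from the piece of x.  Such a word exists from every
    piece, and values of g in the same piece are comparable, so each of the
    #|I|^2 terms at x is bounded by one term at y. *)
Lemma transfer2_harnack (B : R) g x y : 0 <= B -> log_lip_cone B g -> XX x -> XX y ->
  transfer a (transfer a g) x <= harnack_constant B * transfer a (transfer a g) y.
Proof.
move=> B0 [g0 gB] [l Xx] [l' Xy].
have g0' z : XX z -> 0 <= g z by move=> [j Xz]; exact: g0 Xz.
have Ly0 z : XX z -> 0 <= transfer a g z by move=> Xz; exact: transfer_ge0.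
have LLy0 : 0 <= transfer a (transfer a g) y by apply: transfer_ge0 => //; exists l'.
have m0 := ms_m_gt0 ms.
have M0 : 0 <= M by apply: le_trans (ltW m0) _; apply: ms_bound_ge; exists x, l.
set T := transfer a (transfer a g) y.
have key i j : a i x * (a j (rho i x) * g (rho j (rho i x))) <=
    M ^+ 2 * expR (2 * B) / m ^+ 2 * T.
  have rhs0 : 0 <= M ^+ 2 * expR (2 * B) / m ^+ 2 * T.
    by apply: mulr_ge0 => //; rewrite divr_ge0 ?sqr_ge0// mulr_ge0 ?sqr_ge0 ?expR_ge0.
  have [->|il] := eqVneq i l; first by rewrite (ms_diag ms Xx) mul0r.
  have Xix := ms_maps ms il Xx.
  have [->|ji] := eqVneq j i; first by rewrite (ms_diag ms Xix) mul0r mulr0.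
  have Xjix := ms_maps ms ji Xix.
  have [i' [i'l i'j]] := ms_other l' j.
  have ji' : j != i' by rewrite eq_sym.
  have Xiy := ms_maps ms i'l Xy.
  have Xjiy := ms_maps ms ji' Xiy.
  have gy0 := g0 _ _ Xjiy.
  have T1 : m ^+ 2 * g (rho j (rho i' y)) <= T.
    rewrite /T /transfer (bigD1 i') //=.
    apply: (@le_trans _ _ (a i' y * transfer a g (rho i' y))); last first.
      rewrite lerDl; apply: sumr_ge0 => i1 _.
      have [->|i1l] := eqVneq i1 l'; first by rewrite (ms_diag ms Xy) mul0r.
      apply: mulr_ge0; first by apply: ms_weight_ge0; exists l'.
      by apply: Ly0; exists i1; exact: (ms_maps ms i1l Xy).
    have /andP[ha _] := ms_bounds ms i'l Xy.
    rewrite expr2 -mulrA; apply: ler_pM => //; rewrite ?mulr_ge0// ?(ltW m0)//.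
    rewrite /transfer (bigD1 j) //=.
    apply: (@le_trans _ _ (a j (rho i' y) * g (rho j (rho i' y)))); last first.
      rewrite lerDl; apply: sumr_ge0 => i1 _.
      have [->|i1l] := eqVneq i1 i'; first by rewrite (ms_diag ms Xiy) mul0r.
      apply: mulr_ge0; first by apply: ms_weight_ge0; exists i'.
      by apply: g0'; exists i1; exact: (ms_maps ms i1l Xiy).
    have /andP[ha' _] := ms_bounds ms ji' Xiy.
    exact: ler_wpM2r.
  have h1 : g (rho j (rho i x)) <= expR (2 * B) * g (rho j (rho i' y)).
    apply: le_trans (gB _ _ _ Xjix Xjiy) _; apply: ler_wpM2r => //.
    by rewrite ler_expR mulrC ler_wpM2r // (ms_dist_le2 ms Xjix Xjiy).
  have /andP[ha1 hb1] := ms_bounds ms il Xx.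
  have /andP[ha2 hb2] := ms_bounds ms ji Xix.
  have g1 := g0 _ _ Xjix.
  apply: (@le_trans _ _ (M * (M * (expR (2 * B) * g (rho j (rho i' y)))))).
    have a10 := le_trans (ltW m0) ha1; have a20 := le_trans (ltW m0) ha2.
    apply: ler_pM => //; first exact: mulr_ge0.
    exact: ler_pM.
  have -> : M * (M * (expR (2 * B) * g (rho j (rho i' y)))) =
     M ^+ 2 * expR (2 * B) / m ^+ 2 * (m ^+ 2 * g (rho j (rho i' y))).
    by field; rewrite gt_eqF.
  apply: ler_wpM2l => //.
  by rewrite divr_ge0 ?sqr_ge0// mulr_ge0 ?sqr_ge0 ?expR_ge0.
apply: (@le_trans _ _ (#|I|%:R ^+ 2 * (M ^+ 2 * expR (2 * B) / m ^+ 2) * T)); last first.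
  by rewrite ler_wpM2r // /harnack_constant lerDr.
rewrite {1}/transfer.
apply: (@le_trans _ _ (\sum_(i : I) \sum_(j : I) M ^+ 2 * expR (2 * B) / m ^+ 2 * T)).
  apply: ler_sum => i _; rewrite /transfer mulr_sumr; apply: ler_sum => j _.
  exact: key.
by rewrite !sumr_const -!mulrnA -[X in X <= _]mulr_natl natrM -expr2 !mulrA.
Qed.

(** The room between sigma * B and B pays for the constant: by convexity,
    exp (sigma t) <= sigma exp t + 1 - sigma, so
    (exp t - exp (sigma t)) G y >= (exp t - 1) (1 - sigma) G y. *)
Lemma log_lip_cone_sub_const (B sigma tau : R) G : 0 <= B -> 0 <= sigma <= 1 ->
  log_lip_cone (sigma * B) G ->
  (forall x, XX x -> tau <= (1 - sigma) * G x) -> 0 <= tau ->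
  log_lip_cone B (fun x => G x - tau).
Proof.
move=> B0 /andP[s0 s1] [G0 GB] Gt t0; split=> [l x Xx|l x y Xx Xy].
  have Xx' : XX x by exists l.
  rewrite subr_ge0; apply: le_trans (Gt _ Xx') _.
  by rewrite ler_piMl ?(G0 _ _ Xx)// lerBlDr lerDl.
have Xy' : XX y by exists l.
have h := GB _ _ _ Xx Xy; have ht := Gt _ Xy'; have Gy := G0 _ _ Xy.
set t := B * dist x y.
have t0' : 0 <= t by rewrite mulr_ge0 ?(ms_dist_ge0 ms).
have conv : expR (sigma * t) <= sigma * expR t + (1 - sigma).
  have sI : Itv.spec (@Itv.num_sem R) (Itv.Real `[0%Z, 1%Z]) sigma.
    by rewrite /= /Itv.num_sem /= in_itv /= s0 s1 num_real.
  have := @convex_expR R (Itv.mk sI) t 0.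
  by rewrite !convRE /= mulr0 addr0 expR0 mulr1.
rewrite -mulrA -/t in h.
have e1 : 1 <= expR t by rewrite -expR0 ler_expR.
apply: (@le_trans _ _ (expR (sigma * t) * G y - tau)); first by rewrite lerD2r.
apply: (@le_trans _ _ ((sigma * expR t + (1 - sigma)) * G y - tau)).
  by rewrite lerD2r ler_wpM2r.
have : 0 <= (expR t - 1) * ((1 - sigma) * G y - tau) by rewrite mulr_ge0 ?subr_ge0.
lra.
Qed.

End Contraction.

Section Mixing.
Variables (a : I -> E -> R) (m M K theta : R).
Hypothesis ms : markov_system a m M K theta.

(** A positive normalized functional on a class V of functions, such as the
    integral of Lipschitz functions.  Positivity is only asked relative to the
    pieces, which carry the measure. *)
Record invariant_mean (V : (E -> R) -> Prop) (Phi : (E -> R) -> R) : Prop :=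
  InvariantMean {
  im_const : forall c, V (fun=> c);
  im_subC : forall g c, V g -> V (fun x => g x - c);
  im_transfer : forall g, V g -> V (transfer a g);
  im_Phi_const : forall c, Phi (fun=> c) = c;
  im_Phi_subC : forall g c, V g -> Phi (fun x => g x - c) = Phi g - c;
  im_Phi_le : forall f g, V f -> V g ->
    (forall x, XX x -> f x <= g x) -> Phi f <= Phi g;
  im_Phi_transfer : forall g, V g -> Phi (transfer a g) = Phi g }.

Variables (V : (E -> R) -> Prop) (Phi : (E -> R) -> R).
Hypothesis im : invariant_mean V Phi.
Variables (B sigma : R).
Hypotheses (B0 : 0 <= B) (s0 : 0 <= sigma) (s1 : sigma < 1).
Hypothesis KB : theta * B + K <= sigma * B.

Let L := transfer a.
Let C := harnack_constant m M B.

Let C0 : 0 < C. Proof. by apply: lt_le_trans (harnack_constant_ge1 _ _ _). Qed.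

Lemma cone_transfer_sharp g : log_lip_cone B g -> log_lip_cone (sigma * B) (L g).
Proof.
move=> gB; apply: (log_lip_cone_weaken ms KB).
exact: (log_lip_cone_transfer ms B0 gB).
Qed.

Let sB : sigma * B <= B. Proof. by rewrite ler_piMl // ltW. Qed.

Lemma cone_transfer g : log_lip_cone B g -> log_lip_cone B (L g).
Proof.
by move=> gB; apply: (log_lip_cone_weaken ms sB); exact: cone_transfer_sharp.
Qed.

Lemma cone_iter_transfer n g : log_lip_cone B g -> log_lip_cone B (iter n L g).
Proof. by move=> gB; elim: n => //= n; exact: cone_transfer. Qed.

Lemma cone_const c : 0 <= c -> log_lip_cone B (fun=> c).
Proof.
move=> c0; split=> // l x y _ _; rewrite ler_peMl // -expR0 ler_expR.
by rewrite mulr_ge0 // (ms_dist_ge0 ms).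
Qed.

Lemma mean_ge0 g : V g -> log_lip_cone B g -> 0 <= Phi g.
Proof.
move=> Vg [g0 _]; rewrite -[leLHS](im_Phi_const im).
by apply: (im_Phi_le im) => //; [exact: (im_const im) | move=> x [l /g0]].
Qed.

(** The mean of L (L g) is Phi g, and the Harnack inequality makes every value
    comparable to it. *)
Lemma transfer2_mean_bounds g x : V g -> log_lip_cone B g -> XX x ->
  Phi g / C <= L (L g) x <= C * Phi g.
Proof.
move=> Vg gB Xx.
have VL := im_transfer im (im_transfer im Vg).
have PL : Phi (L (L g)) = Phi g.
  by rewrite !(im_Phi_transfer im) //; exact: (im_transfer im).
rewrite -{1 2}PL ler_pdivrMr // mulrC.
apply/andP; split.
  rewrite -[leRHS](im_Phi_const im); apply: (im_Phi_le im) => //.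
    exact: (im_const im).
  by move=> y Xy; exact: (transfer2_harnack ms).
rewrite mulrC -ler_pdivrMr // -[leLHS](im_Phi_const im); apply: (im_Phi_le im) => //.
  exact: (im_const im).
by move=> y Xy; rewrite ler_pdivrMr // mulrC; exact: (transfer2_harnack ms).
Qed.

Lemma iter_transfer_const c n :
  iter n L (fun=> c) = (fun x => c * iter n L (fun=> 1) x).
Proof.
by rewrite -iter_transfer_scale; congr (iter _ _ _); apply/funext => x; rewrite mulr1.
Qed.

Let tau := (1 - sigma) / C.

Lemma coupling_rate : 0 <= 1 - tau < 1.
Proof.
rewrite /tau ltrBlDr ltrDl divr_gt0 ?subr_gt0 // andbT subr_ge0.
rewrite ler_pdivrMr // mul1r; apply: (@le_trans _ _ 1).
  by rewrite lerBlDr lerDl.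
exact: harnack_constant_ge1.
Qed.

(** Coupling.  By the Harnack inequality L (L g) dominates the constant
    tau * Phi g, which can be removed from both functions without leaving the
    cone.  Their difference does not see the removal, while the mean of what
    remains has shrunk by the factor 1 - tau. *)
Lemma transfer_mixing n g1 g2 x : V g1 -> V g2 ->
  log_lip_cone B g1 -> log_lip_cone B g2 -> Phi g1 = Phi g2 -> XX x ->
  `|iter n.*2.+2 L g1 x - iter n.*2.+2 L g2 x| <= (1 - tau) ^+ n * (C * Phi g1).
Proof.
have /andP[t0 t1] := coupling_rate.
have tau0 : 0 <= tau by rewrite /tau divr_ge0 // ?subr_ge0 ltW.
elim: n g1 g2 => [|n IH] g1 g2 V1 V2 B1 B2 P12 Xx.
  have /andP[l1 u1] := transfer2_mean_bounds V1 B1 Xx.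
  have /andP[l2 u2] := transfer2_mean_bounds V2 B2 Xx.
  have p1 : 0 <= Phi g1 / C by rewrite divr_ge0 ?mean_ge0 // ltW.
  (* both values lie between 0 and C * Phi g1 *)
  rewrite expr0 mul1r /= ler_norml.
  move: l1 u1 l2 u2; rewrite -P12 /= => l1 u1 l2 u2; apply/andP; split; lra.
have step g : V g -> log_lip_cone B g ->
    [/\ V (fun x => L (L g) x - tau * Phi g),
        log_lip_cone B (fun x => L (L g) x - tau * Phi g) &
        Phi (fun x => L (L g) x - tau * Phi g) = (1 - tau) * Phi g].
  move=> Vg Bg; have VL := im_transfer im (im_transfer im Vg).
  have PL : Phi (L (L g)) = Phi g.
    by rewrite !(im_Phi_transfer im) //; exact: (im_transfer im).
  split; first exact: (im_subC im).
    apply: (log_lip_cone_sub_const ms (sigma := sigma)) => //.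
    - by rewrite s0 ltW.
    - by apply: cone_transfer_sharp; exact: cone_transfer.
    - move=> y Xy; have /andP[ly _] := transfer2_mean_bounds Vg Bg Xy.
      rewrite /tau -mulrA [C^-1 * _]mulrC ler_wpM2l // subr_ge0; exact: ltW.
    - by rewrite mulr_ge0 // mean_ge0.
  by rewrite (im_Phi_subC im) // PL; ring.
have [V1' B1' P1'] := step _ V1 B1; have [V2' B2' P2'] := step _ V2 B2.
have e12 : Phi (fun x => L (L g1) x - tau * Phi g1) =
           Phi (fun x => L (L g2) x - tau * Phi g2) by rewrite P1' P2' P12.
have := IH _ _ V1' V2' B1' B2' e12 Xx.
rewrite P1' !iter_transfer_sub P12.
have it g : iter (n.+1).*2.+2 L g = iter n.*2.+2 L (L (L g)).
  by rewrite doubleS -!iterSr.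
rewrite !it exprSr; set u := (X in `|X| <= _ -> _); set v := (X in _ -> `|X| <= _).
have -> : u = v by rewrite /u /v; ring.
by move=> h; apply: le_trans h _; rewrite le_eqVlt; apply/orP; left; apply/eqP; ring.
Qed.

Section Perturbation.
Variables (J : finType) (w : J -> R) (z : J -> E).
Hypotheses (w0 : forall l, 0 <= w l) (w1 : \sum_l w l = 1) (zX : forall l, XX (z l)).

Definition atomic_mean (g : E -> R) : R := \sum_l w l * g (z l).
Local Notation Psi := atomic_mean.

Lemma atomic_mean_le f g : (forall x, XX x -> f x <= g x) -> Psi f <= Psi g.
Proof. by move=> fg; apply: ler_sum => l _; rewrite ler_wpM2l // fg. Qed.

Lemma atomic_mean_scale c g : Psi (fun x => c * g x) = c * Psi g.
Proof. by rewrite /Psi mulr_sumr; apply: eq_bigr => l _; rewrite mulrCA. Qed.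

Lemma atomic_mean_const c : Psi (fun=> c) = c.
Proof. by rewrite /Psi -mulr_suml w1 mul1r. Qed.

Variables (s : I -> E -> R) (u0 u1 h b : R).
Hypothesis u00 : 0 < u0.
Hypothesis su : forall i l x, i != l -> X l x -> u0 <= s i x <= u1.

Let L' := transfer (tilted_weight a s h).

Hypothesis almost_invariant : forall g, log_lip_cone B g ->
  expR (- b) * Psi (L' g) <= Psi g <= expR b * Psi (L' g).

(** - h * s i x is the logarithm of the factor by which the tilt changes the
    weight of the letter i at x. *)
Lemma perturbed_le c g x : (forall i l, i != l -> X l x -> - h * s i x <= c) ->
  log_lip_cone B g -> XX x -> L' g x <= expR c * L g x.
Proof.
move=> hc [g0 _] [l Xx]; rewrite /L' /L /transfer mulr_sumr; apply: ler_sum => i _.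
have [->|il] := eqVneq i l; first by rewrite /tilted_weight (ms_diag ms Xx) !mul0r mulr0.
rewrite /tilted_weight mulrAC [X in X <= _]mulrC ler_wpM2r ?ler_expR ?(hc _ l) //.
apply: mulr_ge0; first by apply: (ms_weight_ge0 ms); exists l.
exact: (g0 _ _ (ms_maps ms il Xx)).
Qed.

Lemma perturbed_ge c g x : (forall i l, i != l -> X l x -> c <= - h * s i x) ->
  log_lip_cone B g -> XX x -> expR c * L g x <= L' g x.
Proof.
move=> hc [g0 _] [l Xx]; rewrite /L' /L /transfer mulr_sumr; apply: ler_sum => i _.
have [->|il] := eqVneq i l; first by rewrite /tilted_weight (ms_diag ms Xx) !mul0r mulr0.
rewrite /tilted_weight mulrAC [X in _ <= X]mulrC ler_wpM2r ?ler_expR ?(hc _ l) //.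
apply: mulr_ge0; first by apply: (ms_weight_ge0 ms); exists l.
exact: (g0 _ _ (ms_maps ms il Xx)).
Qed.

(** If y < 0 the right-hand side would tend to 0. *)
Lemma geometric_growth_ge1 (y D : R) :
  (forall n, 1 <= expR (n%:R * y) * D) -> 0 <= y.
Proof.
move=> hD; rewrite leNgt; apply/negP => y0.
have D0 : 0 < D by have := hD 0%N; rewrite mul0r expR0 mul1r; lra.
have [n hn] : exists n : nat, D / (- y) < n%:R.
  exists (Num.bound (D / - y)); apply: archi_boundP.
  by rewrite divr_ge0 ?oppr_ge0 // ltW.
have := hD n; rewrite mulrC -ler_pdivrMr ?expR_gt0 // div1r -expRN.
rewrite ltr_pdivrMr ?oppr_gt0 // in hn.
have := expR_ge1Dx (- (n%:R * y)); lra.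
Qed.

Lemma iter_const1_mean_bounds n : C^-1 <= Psi (iter n.+2 L (fun=> 1)) <= C.
Proof.
have V1 : V (iter n L (fun=> 1)).
  by elim: n => [|n] /=; [exact: (im_const im) | exact: (im_transfer im)].
have B1 : log_lip_cone B (iter n L (fun=> 1)).
  by apply: cone_iter_transfer; exact: cone_const.
have P1 : Phi (iter n L (fun=> 1)) = 1.
  elim: n {B1} V1 => [|n IH] /= V1; first exact: (im_Phi_const im).
  have V1' : V (iter n L (fun=> 1)).
    by elim: n {IH V1} => [|n] /=; [exact: (im_const im) | exact: (im_transfer im)].
  by rewrite (im_Phi_transfer im) // IH.
apply/andP; split; [rewrite -[leLHS]atomic_mean_const|rewrite -[leRHS]atomic_mean_const];
  apply: atomic_mean_le => x Xx;
  by have := transfer2_mean_bounds V1 B1 Xx; rewrite P1 mul1r mulr1 => /andP[].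
Qed.

Lemma mean_le_iter_transfer c : (forall g, log_lip_cone B g -> Psi g <= expR c * Psi (L g)) ->
  forall n g, log_lip_cone B g -> Psi g <= expR (n%:R * c) * Psi (iter n L g).
Proof.
move=> hc n g gB; elim: n => [|n IH]; first by rewrite mul0r expR0 mul1r.
apply: le_trans IH _; rewrite -addn1 natrD mulrDl mul1r expRD -mulrA ler_wpM2l ?expR_ge0 //.
by rewrite addn1; apply: hc; exact: cone_iter_transfer.
Qed.

Lemma mean_ge_iter_transfer c : (forall g, log_lip_cone B g -> expR c * Psi (L g) <= Psi g) ->
  forall n g, log_lip_cone B g -> expR (n%:R * c) * Psi (iter n L g) <= Psi g.
Proof.
move=> hc n g gB; elim: n => [|n IH]; first by rewrite mul0r expR0 mul1r.
apply: le_trans IH; rewrite -addn1 natrD mulrDl mul1r expRD -mulrA ler_wpM2l ?expR_ge0 //.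
by rewrite addn1; apply: hc; exact: cone_iter_transfer.
Qed.

(** One step of L' costs Psi a factor between exp (- b) and exp b, and passing
    from L' to L another factor exp (- |h| u0) if h >= 0, or exp (|h| u0) if
    h < 0.  The means of the iterates of 1 under L stay bounded away from 0 and
    infinity, which leaves no room for an exponential drift. *)
Lemma exponent_gap : `|h| * u0 <= b.
Proof.
rewrite -subr_ge0; set y := b - _.
apply: (@geometric_growth_ge1 _ (expR (2 * y) * C)) => n.
(* the bounds on the iterates of 1 hold from the second one on *)
have -> : expR (n%:R * y) * (expR (2 * y) * C) = expR (n.+2%:R * y) * C.
  by rewrite mulrA -expRD -(addn2 n) natrD [in RHS]mulrDl.
have c1 : log_lip_cone B (fun=> 1) by exact: cone_const.
have /andP[lo up] := iter_const1_mean_bounds n.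
have [h0|h0] := lerP 0 h.
  have hc g : log_lip_cone B g -> Psi g <= expR y * Psi (L g).
    move=> gB; have /andP[_ h1] := almost_invariant gB; apply: le_trans h1 _.
    rewrite /y expRD -mulrA ler_wpM2l ?expR_ge0 // -atomic_mean_scale.
    apply: atomic_mean_le => x Xx; apply: perturbed_le => // i l il Xl.
    have /andP[] := su il Xl.
    by rewrite ger0_norm // mulNr lerN2 => ? _; rewrite ler_wpM2l.
  have := mean_le_iter_transfer hc n.+2 c1; rewrite atomic_mean_const.
  by move=> h1; apply: le_trans h1 _; rewrite ler_wpM2l ?expR_ge0.
have hc g : log_lip_cone B g -> expR (- y) * Psi (L g) <= Psi g.
  move=> gB; have /andP[+ _] := almost_invariant gB; apply: le_trans.
  rewrite /y opprB addrC expRD -mulrA ler_wpM2l ?expR_ge0 // -atomic_mean_scale.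
  apply: atomic_mean_le => x Xx; apply: perturbed_ge => // i l il Xl.
  have /andP[] := su il Xl.
  by rewrite ltr0_norm // => ? _; rewrite ler_wpM2l // oppr_ge0 ltW.
have := mean_ge_iter_transfer hc n.+2 c1; rewrite atomic_mean_const mulrN expRN.
rewrite mulrC ler_pdivrMr ?expR_gt0 // mul1r => h1.
by rewrite mulrC -ler_pdivrMl // mulr1; apply: le_trans h1.
Qed.

Let kappa := 1 + u1 / u0.

Let drift_le : (exists i l x, i != l /\ X l x) -> b + `|h| * u1 <= kappa * b.
Proof.
move=> [i [l [x [il Xx]]]]; have /andP[su0 su1] := su il Xx.
have u10 : 0 <= u1 by apply: le_trans (ltW u00) _; exact: le_trans su1.
rewrite /kappa mulrDl mul1r lerD2l.
have -> : `|h| * u1 = u1 / u0 * (`|h| * u0) by field; rewrite gt_eqF.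
by rewrite ler_wpM2l ?exponent_gap // divr_ge0 // ltW.
Qed.

(** Since |h| u0 <= b, removing the tilt costs at most a factor
    exp (|h| u1) <= exp (b u1 / u0) on either side. *)
Lemma almost_invariant_unperturbed g : log_lip_cone B g ->
  expR (- (kappa * b)) * Psi (L g) <= Psi g <= expR (kappa * b) * Psi (L g).
Proof.
move=> gB.
have [l1 _] : exists l1 : J, True.
  have [l1 _|noJ] := pickP (@predT J); first by exists l1.
  by have := w1; rewrite big_pred0 // => /eqP; rewrite eq_sym oner_eq0.
have [l Xz] := zX l1; have [i [il _]] := ms_other ms l l.
have gap : b + `|h| * u1 <= kappa * b by apply: drift_le; exists i, l, (z l1).
have sb i' l' x : i' != l' -> X l' x -> `|- h * s i' x| <= `|h| * u1.
  move=> il' Xx; have /andP[? ?] := su il' Xx; rewrite normrM normrN ler_wpM2l //.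
  by rewrite ger0_norm // (le_trans (ltW u00)).
have /andP[lo up] := almost_invariant gB; apply/andP; split.
  apply: le_trans lo.
  apply: (@le_trans _ _ (expR (- b) * (expR (- (`|h| * u1)) * Psi (L g)))).
    rewrite mulrA -expRD ler_wpM2r // ?ler_expR ?opprD -?opprD ?lerN2 //.
    by apply: sumr_ge0 => l' _; rewrite mulr_ge0 //; apply: (transfer_ge0 ms) => //
      y [l'' Xy]; exact: (gB.1 _ _ Xy).
  rewrite ler_wpM2l ?expR_ge0 // -atomic_mean_scale.
  apply: atomic_mean_le => x Xx; apply: perturbed_ge => // i' l' il' Xl'.
  by have := sb _ _ _ il' Xl'; rewrite ler_norml => /andP[].
apply: le_trans up _.
apply: (@le_trans _ _ (expR b * (expR (`|h| * u1) * Psi (L g)))); last first.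
  rewrite mulrA -expRD ler_wpM2r // ?ler_expR //.
  by apply: sumr_ge0 => l' _; rewrite mulr_ge0 //; apply: (transfer_ge0 ms) => //
    y [l'' Xy]; exact: (gB.1 _ _ Xy).
rewrite ler_wpM2l ?expR_ge0 // -atomic_mean_scale.
apply: atomic_mean_le => x Xx; apply: perturbed_le => // i' l' il' Xl'.
by have := sb _ _ _ il' Xl'; rewrite ler_norml => /andP[].
Qed.

(** Psi f is compared to Psi (L^n f), then to Phi f * Psi (L^n 1), then to
    Phi f * Psi 1 = Phi f. *)
Lemma atomic_mean_sandwich n (f : E -> R) (eta : R) :
  V f -> log_lip_cone B f ->
  (forall x, XX x -> `|iter n L f x - Phi f * iter n L (fun=> 1) x| <= eta) ->
  expR (- (n%:R * (kappa * b))) * (Phi f * expR (- (n%:R * (kappa * b))) - eta)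
    <= Psi f <=
  expR (n%:R * (kappa * b)) * (Phi f * expR (n%:R * (kappa * b)) + eta).
Proof.
move=> Vf fB hn.
have c1 : log_lip_cone B (fun=> 1) by exact: cone_const.
have up g := fun gB => proj2 (andP (@almost_invariant_unperturbed g gB)).
have lo g := fun gB => proj1 (andP (@almost_invariant_unperturbed g gB)).
have uf := mean_le_iter_transfer up n fB; have lf := mean_ge_iter_transfer lo n fB.
have u1' := mean_le_iter_transfer up n c1; have l1' := mean_ge_iter_transfer lo n c1.
rewrite atomic_mean_const in u1' l1'; rewrite !mulrN in lf l1'.
set q := n%:R * (kappa * b) in uf lf u1' l1' *.
have P0 : 0 <= Phi f by exact: mean_ge0.
have hP : `|Psi (iter n L f) - Phi f * Psi (iter n L (fun=> 1))| <= eta.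
  rewrite -atomic_mean_scale /Psi -sumrB.
  apply: le_trans (ler_norm_sum _ _ _) _.
  rewrite -[leRHS](atomic_mean_const eta); apply: ler_sum => l _.
  by rewrite -mulrBr normrM ger0_norm // ler_wpM2l // hn.
rewrite ler_norml in hP; case/andP: hP => hP1 hP2.
apply/andP; split.
  apply: le_trans lf; rewrite ler_wpM2l ?expR_ge0 //.
  have : expR (- q) <= Psi (iter n L (fun=> 1)).
    by rewrite expRN -div1r ler_pdivrMr ?expR_gt0 // mulrC.
  by move=> /(ler_wpM2l P0); lra.
apply: le_trans uf _; rewrite ler_wpM2l ?expR_ge0 //.
have : Psi (iter n L (fun=> 1)) <= expR q.
  by move: l1'; rewrite expRN mulrC ler_pdivrMr ?expR_gt0 // mul1r.
by move=> /(ler_wpM2l P0); lra.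
Qed.

End Perturbation.

(** Mixing for the pair formed by f and the constant of the same mean. *)
Lemma iter_transfer_asymptotics f eta : V f -> log_lip_cone B f -> 0 < eta ->
  exists n, forall x, XX x ->
    `|iter n L f x - Phi f * iter n L (fun=> 1) x| <= eta.
Proof.
move=> Vf Bf eta0; have P0 := mean_ge0 Vf Bf.
have /andP[t0 t1] := coupling_rate.
have CP0 : 0 <= C * Phi f by rewrite mulr_ge0 // ltW.
have [n hn] : exists n, (1 - tau) ^+ n * (C * Phi f) <= eta.
  have [CPz|CPn] := eqVneq (C * Phi f) 0; first by exists 0%N; rewrite CPz mulr0 ltW.
  have CPgt : 0 < C * Phi f by rewrite lt_neqAle eq_sym CPn.
  have : (1 - tau) ^+ n @[n --> \oo] --> 0.
    by apply: cvg_expr; rewrite ger0_norm.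
  move/cvgrPdist_le => /(_ (eta / (C * Phi f)) (divr_gt0 eta0 CPgt)) [n _ hn].
  exists n; rewrite -ler_pdivlMr //; have := hn n (leqnn n).
  by rewrite /= sub0r normrN ger0_norm // exprn_ge0.
exists n.*2.+2 => x Xx; apply: le_trans hn.
have -> : Phi f * iter n.*2.+2 L (fun=> 1) x = iter n.*2.+2 L (fun=> Phi f) x.
  by rewrite [in RHS]iter_transfer_const.
apply: transfer_mixing => //; last by rewrite (im_Phi_const im).
  exact: (im_const im).
exact: cone_const.
Qed.

(** The invariant mean is the only limit of almost invariant atomic means.  The
    bound b0 is uniform in the atoms and in the exponent h, because the almost
    invariance itself forces h to be small. *)
Lemma atomic_mean_limit (f : E -> R) (s : I -> E -> R) (u0 u1 eta : R) :
  V f -> log_lip_cone B f -> 0 < u0 <= u1 -> 0 < eta ->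
  (forall i l x, i != l -> X l x -> u0 <= s i x <= u1) ->
  exists2 b0, 0 < b0 & forall (J : finType) (w : J -> R) (z : J -> E) (h b : R),
    (forall l, 0 <= w l) -> \sum_l w l = 1 -> (forall l, XX (z l)) ->
    0 <= b < b0 ->
    (forall g, log_lip_cone B g ->
      expR (- b) * atomic_mean w z (transfer (tilted_weight a s h) g) <=
      atomic_mean w z g <=
      expR b * atomic_mean w z (transfer (tilted_weight a s h) g)) ->
    `|atomic_mean w z f - Phi f| <= eta.
Proof.
move=> Vf Bf /andP[u00 u01] eta0 su.
have P0 := mean_ge0 Vf Bf.
have [n hn] := iter_transfer_asymptotics Vf Bf (divr_gt0 eta0 (ltr0n _ 4)).
set kappa := 1 + u1 / u0.
have k0 : 0 < kappa by rewrite ltr_wpDr // divr_ge0 // ltW // (lt_le_trans u00).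
set c := Phi f.
(* with exp (2 q) <= 1 + r the multiplicative errors cost at most eta / 2 and at
   most double the additive error eta / 4 *)
pose r := Num.min 1 (eta / (2 * (c + 1))).
have r0 : 0 < r by rewrite lt_min ltr01 divr_gt0 // mulr_gt0 // ltr_wpDl.
have r1 : r <= 1 by rewrite ge_min lexx.
have rc : c * r <= eta / 2.
  apply: (@le_trans _ _ (c * (eta / (2 * (c + 1))))).
    by rewrite ler_wpM2l // ge_min lexx orbT.
  have -> : c * (eta / (2 * (c + 1))) = (eta / 2) * (c / (c + 1)).
    by field; rewrite gt_eqF // ltr_wpDl.
  by rewrite ler_piMr ?divr_ge0 ?(ltW eta0) // ler_pdivrMr ?mul1r ?lerDl // ltr_wpDl.
have q0 : 0 < ln (1 + r) by rewrite ln_gt0 // ltrDl.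
exists (ln (1 + r) / (2 * n.+1%:R * kappa)).
  by rewrite divr_gt0 // !mulr_gt0.
move=> J w z h b w0 w1 zX /andP[b0 bb0] ai.
have := atomic_mean_sandwich w0 w1 zX u00 su ai Vf Bf hn.
rewrite -/kappa -/c; set q := n%:R * (kappa * b).
have q_ge0 : 0 <= q by rewrite !mulr_ge0 // ltW.
have hq : expR q * expR q <= 1 + r.
  rewrite -expRD -[leRHS]lnK ?posrE ?addr_gt0 // ler_expR.
  rewrite ltr_pdivlMr ?mulr_gt0 // in bb0; apply: ltW; apply: le_lt_trans bb0.
  have -> : b * (2 * n.+1%:R * kappa) = q + q + 2 * (kappa * b).
    by rewrite /q -addn1 natrD; ring.
  by rewrite lerDl !mulr_ge0 // ltW.
have e1 : 1 <= expR q by rewrite -expR0 ler_expR.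
have e0 := expR_gt0 (- q).
have ee : expR (- q) * expR q = 1 by rewrite -expRD addNr expR0.
set e := expR q in hq e1 ee *; set e' := expR (- q) in e0 ee *.
have e2 : e <= 2 by have : e <= e * e; [rewrite ler_peMr //; lra | lra].
have e'1 : e' <= 1 by rewrite -ee ler_peMr // ltW.
move=> /andP[lo up]; rewrite ler_norml; apply/andP; split.
  have h2 : 1 - e' * e' <= r.
    suff : 2 - e' * e' <= e * e by lra.
    have -> : e * e = e * e + 2 * (1 - e' * e) by rewrite ee; ring.
    have := sqr_ge0 (e - e'); rewrite sqrrB expr2 expr2 -mulr_natl [e * e']mulrC ee; lra.
  have := ler_wpM2l P0 h2; rewrite -/c => h3.
  have h4 : e' * (eta / 4) <= eta / 4 by rewrite ler_piMl // divr_ge0 // ltW.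
  have e5 : e' * (c * e' - eta / 4) = c - c * (1 - e' * e') - e' * (eta / 4) by ring.
  by rewrite e5 in lo; lra.
have h3 := ler_wpM2l P0 hq; rewrite -/c in h3.
have h4 : e * (eta / 4) <= 2 * (eta / 4) by rewrite ler_wpM2r // divr_ge0 // ltW.
have e5 : e * (c * e + eta / 4) = c * (e * e) + e * (eta / 4) by ring.
by rewrite e5 in up; lra.
Qed.

End Mixing.

End TransferOperator.

(** * Disks and inversions *)

Section PlaneGeometry.
Variable R : realType.
Implicit Types (z x y : Cplx R) (D P : Cplx R * R).

Local Notation Re := complex.Re.
Local Notation Im := complex.Im.

Lemma modulus_sqr z : modulus z ^+ 2 = Re z ^+ 2 + Im z ^+ 2.
Proof. by case: z => a b; rewrite /modulus /= sqr_sqrtr // addr_ge0 ?sqr_ge0. Qed.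

Lemma modulus_ge0 z : 0 <= modulus z.
Proof. by case: z => a b; exact: sqrtr_ge0. Qed.

Lemma modulus_leP z r : 0 <= r -> (modulus z <= r) = (Re z ^+ 2 + Im z ^+ 2 <= r ^+ 2).
Proof. by move=> r0; rewrite -modulus_sqr ler_pXn2r // nnegrE modulus_ge0. Qed.

Lemma modulus_le_ReIm z : modulus z <= `|Re z| + `|Im z|.
Proof.
rewrite modulus_leP ?addr_ge0 // sqrrD !real_normK ?num_real //.
by rewrite -addrA [X in _ <= _ + X]addrC lerD2l lerDl mulrn_wge0 // mulr_ge0.
Qed.

Lemma modulusD x y : modulus (x + y) <= modulus x + modulus y.
Proof. exact: le_normcD. Qed.

Lemma modulusN x : modulus (- x) = modulus x.
Proof. exact: normcN. Qed.

Lemma modulus_distC x y : modulus (x - y) = modulus (y - x).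
Proof. by rewrite -modulusN opprB. Qed.

Lemma modulusM x y : modulus (x * y) = modulus x * modulus y.
Proof. exact: ComplexField.Normc.normcM. Qed.

Lemma modulusV x : modulus (x^-1) = (modulus x)^-1.
Proof. exact: ComplexField.Normc.normcV. Qed.

Lemma modulus0 : modulus (0 : Cplx R) = 0.
Proof. exact: ComplexField.Normc.normc0. Qed.

Lemma modulus_eq0 x : modulus x = 0 -> x = 0.
Proof. exact: ComplexField.Normc.eq0_normc. Qed.

Lemma modulus_gt0 x : x != 0 -> 0 < modulus x.
Proof.
by move=> x0; rewrite lt_neqAle modulus_ge0 andbT eq_sym; apply: contra x0 => /eqP/modulus_eq0 ->.
Qed.

Lemma modulus_real (r : R) : modulus (r%:C : Cplx R) = `|r|.
Proof. by rewrite /modulus /= expr0n addr0 sqrtr_sqr. Qed.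

Lemma modulus_conj x : modulus (conjc x) = modulus x.
Proof. by case: x => a b; rewrite /modulus /= sqrrN. Qed.

Lemma modulus_dist_triangle x y z : modulus (x - z) <= modulus (x - y) + modulus (y - z).
Proof. by have := modulusD (x - y) (y - z); rewrite addrA subrK. Qed.

(** Orthogonality to S^1, read off from the right angle at a common point. *)
Definition normal_to_S1 D : Prop := 0 < D.2 /\ modulus D.1 ^+ 2 = 1 + D.2 ^+ 2.

Lemma orthogonal_unit_normal D : 0 < D.2 -> orthogonal_circles D (unit_disk R) ->
  normal_to_S1 D.
Proof.
move=> D0 [[z [Dz Uz]] orth]; split=> //; have := orth z Dz Uz.
move: Dz Uz; rewrite /circle /= subr0 => /(congr1 (fun t => t ^+ 2)) + /(congr1 (fun t => t ^+ 2)).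
rewrite !modulus_sqr expr1n; case: D D0 {orth} => [[a b] r] /= r0; case: z => x y /=; nra.
Qed.

(** Test the inclusion on the point of D farthest from the centre of P. *)
Lemma cdisk_sub D P : cdisk D `<=` cdisk P -> 0 <= D.2 ->
  modulus (D.1 - P.1) + D.2 <= P.2.
Proof.
case: D P => c r [c' r'] /= sub r0.
have [cc|cc] := eqVneq c c'.
  rewrite cc subrr modulus0 add0r; have := sub (c' + r%:C); rewrite /cdisk /= -cc.
  by rewrite [c + _]addrC addrK modulus_real ger0_norm // => /(_ (lexx _)).
have m0 : 0 < modulus (c - c') by rewrite modulus_gt0 // subr_eq0.
set v := (r / modulus (c - c'))%:C : Cplx R.
have := sub (c + v * (c - c')); rewrite /cdisk /= addrAC subrr add0r.
rewrite modulusM modulus_real ger0_norm ?divr_ge0 ?modulus_ge0 // divfK ?gt_eqF //.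
move=> /(_ (lexx _)).
have -> : c + v * (c - c') - c' = (1 + v) * (c - c') by rewrite mulrDl mul1r addrAC.
have -> : 1 + v = (1 + r / modulus (c - c'))%:C by rewrite /v rmorphD.
rewrite modulusM modulus_real ger0_norm; last first.
  by rewrite addr_ge0 // divr_ge0 // modulus_ge0.
by rewrite mulrDl mul1r divfK ?gt_eqF.
Qed.

Lemma cdisk_inj D P : 0 <= D.2 -> cdisk D = cdisk P -> D = P.
Proof.
move=> D0 DP.
have h1 : modulus (D.1 - P.1) + D.2 <= P.2 by apply: cdisk_sub => //; rewrite DP.
have P0 : 0 <= P.2 by apply: le_trans h1; rewrite addr_ge0 // modulus_ge0.
have h2 : modulus (P.1 - D.1) + P.2 <= D.2 by apply: cdisk_sub => //; rewrite DP.
have m0 := modulus_ge0 (D.1 - P.1).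
rewrite modulus_distC in h2.
have/modulus_eq0/eqP : modulus (D.1 - P.1) = 0 by lra.
rewrite subr_eq0 => /eqP e1; have e2 : D.2 = P.2 by lra.
by case: D P e1 e2 {DP D0 h1 P0 h2 m0} => [? ?] [? ?] /= -> ->.
Qed.

Lemma cdisk_center D : 0 <= D.2 -> cdisk D D.1.
Proof. by rewrite /cdisk /= subrr modulus0. Qed.

(** Otherwise the point dividing the segment of the centres in the ratio of the
    radii is in both disks. *)
Lemma cdisk_disjoint D P : 0 < D.2 -> 0 < P.2 -> cdisk D `&` cdisk P = set0 ->
  D.2 + P.2 < modulus (D.1 - P.1).
Proof.
case: D P => c r [c' r'] /= r0 r0' dis; rewrite ltNge; apply/negP => h.
have s0 : 0 < r + r' by rewrite addr_gt0.
have n0 (t : R) : 0 <= t -> modulus ((t / (r + r'))%:C * (c - c')) <= t.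
  move=> t0; rewrite modulusM modulus_real ger0_norm ?divr_ge0 // ?(ltW s0) //.
  by rewrite mulrAC ler_pdivrMr // ler_wpM2l.
suff : (cdisk (c, r) `&` cdisk (c', r')) (c - (r / (r + r'))%:C * (c - c')).
  by rewrite dis.
split; rewrite /cdisk /=.
  by rewrite addrAC subrr add0r modulusN n0 // ltW.
have -> : c - (r / (r + r'))%:C * (c - c') - c' = (r' / (r + r'))%:C * (c - c').
  have -> : (r' / (r + r'))%:C = 1 - (r / (r + r'))%:C :> Cplx R.
    apply/eqP; rewrite eq_sym subr_eq -rmorphD /= -mulrDl [r' + r]addrC divff //; exact: lt0r_neq0.
  by rewrite mulrBl mul1r addrAC.
by rewrite n0 // ltW.
Qed.

Lemma inversion_sub D x : inversion D x - D.1 = (D.2 ^+ 2)%:C / conjc (x - D.1).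
Proof. by rewrite /inversion addrAC subrr add0r. Qed.

Lemma inversionK D : D.2 != 0 -> involutive (inversion D).
Proof.
move=> r0 x; rewrite {1}/inversion inversion_sub.
have -> (u v : R[i]) : conjc (u / conjc v) = conjc u / v.
  by rewrite [LHS]rmorphM /= conjc_inv conjcK.
rewrite conjc_real invfM invrK mulrA.
rewrite divff ?mul1r; first by rewrite addrC subrK.
by rewrite -[0]/(0%:C) (inj_eq (@complexI _)) expf_eq0.
Qed.

Lemma modulus_inversion_sub D x : modulus (inversion D x - D.1) = D.2 ^+ 2 / modulus (x - D.1).
Proof.
by rewrite inversion_sub modulusM modulusV modulus_conj modulus_real ger0_norm ?sqr_ge0.
Qed.

Lemma modulus_inversion_dist D x y : x != D.1 -> y != D.1 ->
  modulus (inversion D x - inversion D y) =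
  D.2 ^+ 2 * modulus (x - y) / (modulus (x - D.1) * modulus (y - D.1)).
Proof.
rewrite -(subr_eq0 x) -(subr_eq0 y) => x0 y0.
have -> : inversion D x - inversion D y =
    (D.2 ^+ 2)%:C * (conjc (y - x) / (conjc (x - D.1) * conjc (y - D.1))).
  rewrite -[inversion D x](subrK D.1) -[inversion D y](subrK D.1) !inversion_sub.
  have -> : y - x = (y - D.1) - (x - D.1) by ring.
  set u := x - D.1 in x0 *; set v := y - D.1 in y0 *.
  have u0 : conjc u != 0 by rewrite conjc_eq0.
  have v0 : conjc v != 0 by rewrite conjc_eq0.
  by rewrite [conjc (v - u)]rmorphB; field; rewrite u0 v0.
rewrite !modulusM modulusV modulusM !modulus_conj modulus_real ger0_norm ?sqr_ge0 //.
by rewrite (modulus_distC y) mulrA.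
Qed.

Lemma inversionE D x : x != D.1 ->
  inversion D x = (Re D.1 + D.2 ^+ 2 * (Re x - Re D.1) / modulus (x - D.1) ^+ 2) +i*
                  (Im D.1 + D.2 ^+ 2 * (Im x - Im D.1) / modulus (x - D.1) ^+ 2).
Proof.
move=> _; rewrite modulus_sqr; case: D => [[a b] r]; case: x => u v; rewrite /inversion /=.
by apply/eqP; rewrite eq_complex /=; apply/andP; split; apply/eqP; rewrite !sqrrN; ring.
Qed.

Lemma modulusB_gt0 x y : x != y -> 0 < modulus (x - y).
Proof. by rewrite -subr_eq0; exact: modulus_gt0. Qed.

(** The image of the disk P under the inversion in D, when the centre of D is
    outside P. *)
Definition invert_disk D P : Cplx R * R :=
  let N := modulus (P.1 - D.1) ^+ 2 - P.2 ^+ 2 in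
  (D.1 + (D.2 ^+ 2 / N)%:C * (P.1 - D.1), D.2 ^+ 2 * P.2 / N).

Lemma invert_disk_gap D P : 0 <= P.2 -> P.2 < modulus (P.1 - D.1) ->
  0 < modulus (P.1 - D.1) ^+ 2 - P.2 ^+ 2.
Proof. by move=> P0 PD; rewrite subr_gt0 ltr_pXn2r // nnegrE // modulus_ge0. Qed.

Lemma inversion_in_invert_disk D P x : 0 < D.2 -> 0 <= P.2 ->
  P.2 < modulus (P.1 - D.1) -> cdisk P x -> cdisk (invert_disk D P) (inversion D x).
Proof.
move=> D0 P0 PD Px; have N0 := invert_disk_gap P0 PD.
have xD : x != D.1.
  apply/eqP => xD; move: Px; rewrite /cdisk /= xD modulus_distC => h.
  by have := le_lt_trans h PD; rewrite ltxx.
have u0 := modulusB_gt0 xD.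
rewrite /cdisk /= modulus_leP; last by rewrite divr_ge0 ?(ltW N0) // mulr_ge0 // sqr_ge0.
rewrite (inversionE xD); move: Px; rewrite /cdisk /= modulus_leP //.
rewrite -subr_ge0 -[_ <= _ ^+ 2]subr_ge0.
have := u0; rewrite -(@ltr_pXn2r _ 2) ?nnegrE ?modulus_ge0 ?expr0n //= => {}u0.

move: u0 N0; rewrite /invert_disk !modulus_sqr /=; case: D D0 {PD xD} => [[a b] r] /= r0.
case: x => x y; case: P P0 => [[c d] s] /= s0 u0 N0 hP.
set N := _ - s ^+ 2 in N0 *; set U := (x - a) ^+ 2 + _ in u0 *.
(* the power of the image point with respect to the image circle is a positive
   multiple of the power of x with respect to P *)
rewrite [leRHS](_ : _ = r ^+ 4 / (N * U) * (s ^+ 2 - ((x - c) ^+ 2 + (y - d) ^+ 2))).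
  by rewrite mulr_ge0 // divr_ge0 ?exprn_even_ge0 // mulr_ge0 // ltW.
by rewrite /N /U; field; rewrite !gt_eqF.
Qed.

Lemma invert_disk_far D P : 0 < D.2 -> 0 <= P.2 -> P.2 < modulus (P.1 - D.1) ->
  (invert_disk D P).2 < modulus ((invert_disk D P).1 - D.1).
Proof.
move=> D0 P0 PD; have N0 := invert_disk_gap P0 PD.
rewrite /invert_disk /= addrAC subrr add0r modulusM modulus_real ger0_norm; last first.
  by rewrite divr_ge0 ?sqr_ge0 // ltW.
by rewrite mulrAC ltr_pM2l // divr_gt0 // exprn_gt0.
Qed.

Lemma invert_diskK D P : 0 < D.2 -> 0 <= P.2 -> P.2 < modulus (P.1 - D.1) ->
  invert_disk D (invert_disk D P) = P.
Proof.
move=> D0 P0 PD; have N0 := invert_disk_gap P0 PD.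
have N0' := lt0r_neq0 N0; have D0' := lt0r_neq0 D0.
case: D P D0 P0 PD N0 N0' D0' => [a r] [c s] /= r0 s0 cs N0 N0' r0'.
rewrite /invert_disk /= addrAC subrr add0r modulusM modulus_real ger0_norm; last first.
  by rewrite divr_ge0 ?sqr_ge0 // ltW.
set N := modulus (c - a) ^+ 2 - s ^+ 2 in N0 N0' *.
have -> : (r ^+ 2 / N * modulus (c - a)) ^+ 2 - (r ^+ 2 * s / N) ^+ 2 = r ^+ 4 / N.
  have -> : (r ^+ 2 / N * modulus (c - a)) ^+ 2 - (r ^+ 2 * s / N) ^+ 2 =
     r ^+ 4 / N ^+ 2 * (modulus (c - a) ^+ 2 - s ^+ 2) by field.
  by rewrite -/N; field.
congr (_, _); last by field; rewrite r0' N0'.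
rewrite mulrA -rmorphM /=.
have -> : r ^+ 2 / (r ^+ 4 / N) * (r ^+ 2 / N) = 1 by field; rewrite r0' N0'.
by rewrite rmorph1 mul1r addrC subrK.
Qed.

Lemma inversion_disk D P : 0 < D.2 -> 0 <= P.2 -> P.2 < modulus (P.1 - D.1) ->
  inversion D @` cdisk P = cdisk (invert_disk D P).
Proof.
move=> D0 P0 PD; apply/seteqP; split=> [_ [x Px <-]|x Px].
  exact: inversion_in_invert_disk.
exists (inversion D x); last by rewrite inversionK // lt0r_neq0.
rewrite -(invert_diskK D0 P0 PD); apply: inversion_in_invert_disk => //.
  by rewrite /invert_disk /= divr_ge0 ?(ltW (invert_disk_gap P0 PD)) // mulr_ge0 ?sqr_ge0.
exact: invert_disk_far.
Qed.

Lemma invert_disk_normal D P : normal_to_S1 D -> normal_to_S1 P ->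
  P.2 < modulus (P.1 - D.1) -> normal_to_S1 (invert_disk D P).
Proof.
move=> [D0 Dn] [P0 Pn] PD; have N0 := invert_disk_gap (ltW P0) PD.
split; first by rewrite /invert_disk /= divr_gt0 // mulr_gt0 // exprn_gt0.
move: N0 Dn Pn; rewrite /invert_disk !modulus_sqr /=.
case: D D0 {PD} => [[a b] r] /= r0; case: P P0 => [[c d] s] /= s0 N0 h1 h2.
set N := _ - s ^+ 2 in N0 *.
have key : N = - 2 * (a * (c - a) + b * (d - b)) - r ^+ 2 by rewrite /N; nra.
have N0' := lt0r_neq0 N0.
apply/eqP; rewrite -subr_eq0; apply/eqP.
rewrite [LHS](_ : _ = (a ^+ 2 + b ^+ 2 - (1 + r ^+ 2)) + r ^+ 2 / N ^+ 2 *
   (N * (2 * (a * (c - a) + b * (d - b)) + N + r ^+ 2) +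
    (r ^+ 2 * (((c - a) ^+ 2 + (d - b) ^+ 2 - s ^+ 2) - N)))); last by field.
by rewrite h1 subrr add0r -/N subrr mulr0 addr0 key; ring.
Qed.

(** With R, r the radii of D, P and c > R + r the distance of their centres, the
    new radius is R^2 r / (c^2 - r^2), and c^2 - r^2 > R^2. *)
Lemma invert_disk_radius D P : 0 < D.2 -> 0 < P.2 ->
  D.2 + P.2 < modulus (P.1 - D.1) -> (invert_disk D P).2 < P.2.
Proof.
move=> D0 P0 PD.
have PD' : P.2 < modulus (P.1 - D.1) by apply: le_lt_trans PD; rewrite lerDr ltW.
have N0 := invert_disk_gap (ltW P0) PD'.
rewrite /invert_disk /= ltr_pdivrMr // mulrC ltr_pM2l // ltrBrDr.
apply: (@le_lt_trans _ _ ((D.2 + P.2) ^+ 2)); first by nra.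
by rewrite ltr_pXn2r // nnegrE ?modulus_ge0 // addr_ge0 // ltW.
Qed.

Lemma S1E z : S1 R z = (modulus z = 1).
Proof. by rewrite /S1 /circle /= subr0. Qed.

Lemma S1_sqr z : S1 R z -> Re z ^+ 2 + Im z ^+ 2 = 1.
Proof. by rewrite S1E -modulus_sqr => ->; rewrite expr1n. Qed.

Lemma sqr_S1 z : Re z ^+ 2 + Im z ^+ 2 = 1 -> S1 R z.
Proof. by case: z => a b /= h; rewrite S1E /modulus /= h sqrtr1. Qed.

Lemma normal_center_gt1 D : normal_to_S1 D -> 1 < modulus D.1.
Proof.
move=> [D0 Dn]; rewrite -(@ltr_pXn2r _ 2) ?nnegrE ?modulus_ge0 // Dn expr1n ltrDl.
exact: exprn_gt0.
Qed.

Lemma S1_neq_center D z : normal_to_S1 D -> S1 R z -> z != D.1.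
Proof.
move=> Dn Sz; apply/eqP => zD; have := normal_center_gt1 Dn.
by rewrite -zD; move: Sz; rewrite S1E => ->; rewrite ltxx.
Qed.

Lemma inversion_S1 D z : normal_to_S1 D -> S1 R z -> S1 R (inversion D z).
Proof.
move=> Dn Sz; have zD := S1_neq_center Dn Sz; have N0 := modulusB_gt0 zD.
apply: sqr_S1; rewrite inversionE // modulus_sqr.
move: N0; rewrite -(@ltr_pXn2r _ 2) ?nnegrE ?modulus_ge0 // expr0n modulus_sqr.
have := S1_sqr Sz; case: Dn => D0; rewrite modulus_sqr.
case: D D0 {zD} => [[a b] r] /= r0; case: z {Sz} => x y /= h1 h2 N0.
set N := (x - a) ^+ 2 + _ in N0 *.
have key : N = 2 + r ^+ 2 - 2 * (a * x + b * y) by rewrite /N; nra.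
have N0' := lt0r_neq0 N0.
apply/eqP; rewrite -subr_eq0; apply/eqP.
rewrite [LHS](_ : _ = (a ^+ 2 + b ^+ 2 - (1 + r ^+ 2)) + r ^+ 2 / N ^+ 2 *
  (N * (N + 2 * (a * x + b * y) - 2 * (a ^+ 2 + b ^+ 2) + r ^+ 2) +
   r ^+ 2 * (((x - a) ^+ 2 + (y - b) ^+ 2) - N))); last by field.
by rewrite h1 -/N key; ring.
Qed.

Lemma inversion_cdisk D x : 0 < D.2 -> D.2 <= modulus (x - D.1) ->
  cdisk D (inversion D x).
Proof.
move=> D0 h; rewrite /cdisk /= modulus_inversion_sub.
by rewrite ler_pdivrMr ?(lt_le_trans D0) // expr2 ler_wpM2l // ltW.
Qed.

Lemma radial_projection_S1 z : z != 0 -> S1 R (radial_projection z).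
Proof.
move=> z0; rewrite S1E /radial_projection modulusM modulusV modulus_real.
by rewrite ger0_norm ?modulus_ge0 // divff // gt_eqF // modulus_gt0.
Qed.

(** The centre c has |c|^2 = 1 + r^2, so |c| - 1 <= r. *)
Lemma radial_projection_cdisk P : normal_to_S1 P ->
  cdisk P (radial_projection P.1) /\ S1 R (radial_projection P.1).
Proof.
move=> Pn; have c1 := normal_center_gt1 Pn; case: Pn => P0 Pn.
have c0 : P.1 != 0 by apply/eqP => e; rewrite e modulus0 ltr10 in c1.
split; last exact: radial_projection_S1.
have m0 := modulus_gt0 c0.
rewrite /cdisk /= /radial_projection.
have -> : P.1 / (modulus P.1)%:C - P.1 = ((modulus P.1)^-1 - 1)%:C * P.1.
  by rewrite rmorphB /= fmorphV mulrBl mul1r mulrC.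
rewrite modulusM modulus_real ler0_norm; last first.
  by rewrite subr_le0 invf_le1 // ltW.
rewrite opprB mulrBl mul1r mulVf ?gt_eqF //; nra.
Qed.


(** On S^1 the coordinates of an inversion along z * cis t have this form, because
    |z * cis t - c|^2 is affine in cos t and sin t. *)
Lemma derive1_trig_quotient (c al be ga n p q : R) : n + p != 0 ->
  derive1 (fun t : R =>
    c + (al * cos t + be * sin t + ga) / (n + p * cos t + q * sin t)) 0 =
  (be * (n + p) - (al + ga) * q) / (n + p) ^+ 2.
Proof.
move=> np0; rewrite derive1E.
have d1 : is_derive (0:R) (1:R) (fun t : R => al * cos t + be * sin t + ga) be.
  by apply: is_derive_eq; rewrite /= sin0 cos0 oppr0 scaler0 add0r addr0 [_%:A]mulr1.
have d2 : is_derive (0:R) (1:R) (fun t : R => n + p * cos t + q * sin t) q.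
  by apply: is_derive_eq; rewrite /= sin0 cos0 oppr0 scaler0 !mulr0 !add0r [_%:A]mulr1.
have nz : (n + p * cos 0 + q * sin 0) != 0 by rewrite sin0 cos0 mulr0 addr0 mulr1.
have d3 := @is_deriveV _ (fun t : R => n + p * cos t + q * sin t) _ _ _ nz d2.
have d4 := is_deriveD (is_derive_cst c (0:R) (1:R)) (is_deriveM d1 d3).
rewrite (@derive_val _ _ _ _ _ _ _ d4) sin0 cos0 !mulr0 !mulr1 addr0 add0r.
rewrite /GRing.scale /=; field => //.
Qed.

Lemma circle_deriv_inversion D z : normal_to_S1 D -> S1 R z ->
  circle_deriv (inversion D) z = (D.2 / modulus (z - D.1)) ^+ 2.
Proof.
move=> Dn Sz.
have St t : S1 R (z * cis t).
  rewrite S1E modulusM; move: Sz; rewrite S1E => ->.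
  by rewrite mul1r /modulus /= cos2Dsin2 sqrtr1.
have zt t := S1_neq_center Dn (St t).
have N0 : 0 < modulus (z - D.1) ^+ 2 by rewrite exprn_gt0 // modulusB_gt0 // S1_neq_center.
case: Dn => D0 Dn; rewrite /circle_deriv.
pose n := 1 + modulus D.1 ^+ 2.
pose p := - 2 * (Re D.1 * Re z + Im D.1 * Im z).
pose q := 2 * (Re D.1 * Im z - Im D.1 * Re z).
have Nt t : modulus (z * cis t - D.1) ^+ 2 = n + p * cos t + q * sin t.
  have := S1_sqr (St t); rewrite modulus_sqr /n modulus_sqr /p /q; clear.
  case: z => x y; case: D => [[a b] r] /=; nra.
have Np : modulus (z - D.1) ^+ 2 = n + p.
  by have := Nt 0; rewrite cos0 sin0 mulr0 addr0 mulr1 /cis cos0 sin0 mulr1.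
have -> : (fun t => Re (inversion D (z * cis t))) = (fun t : R => Re D.1 +
    ((D.2 ^+ 2 * Re z) * cos t + (- D.2 ^+ 2 * Im z) * sin t + (- D.2 ^+ 2 * Re D.1)) /
    (n + p * cos t + q * sin t)).
  apply/funext => t; rewrite inversionE // Nt /=; congr (_ + _ / _).
  by case: z {Sz St zt N0 Np} @p @q Nt => x y /= _; ring.
have -> : (fun t => Im (inversion D (z * cis t))) = (fun t : R => Im D.1 +
    ((D.2 ^+ 2 * Im z) * cos t + (D.2 ^+ 2 * Re z) * sin t + (- D.2 ^+ 2 * Im D.1)) /
    (n + p * cos t + q * sin t)).
  apply/funext => t; rewrite inversionE // Nt /=; congr (_ + _ / _).
  by case: z {Sz St zt N0 Np} @p @q Nt => x y /= _; ring.
have np0 : n + p != 0 by rewrite -Np gt_eqF.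
rewrite !derive1_trig_quotient // -Np.
have S1z := S1_sqr Sz.
transitivity (Num.sqrt ((D.2 ^+ 2 / modulus (z - D.1) ^+ 2) ^+ 2)); last first.
  by rewrite sqrtr_sqr -expr_div_n ger0_norm // sqr_ge0.
congr (Num.sqrt _).
set N := modulus (z - D.1) ^+ 2 in N0 Np *.
have NE : N = (Re z - Re D.1) ^+ 2 + (Im z - Im D.1) ^+ 2.
  by rewrite /N modulus_sqr; clear; case: z => x y; case: D => [[a b] r].
apply/eqP; rewrite -subr_eq0; apply/eqP.
rewrite [LHS](_ : _ = D.2 ^+ 4 / N ^+ 4 * (N ^+ 2 * (Re z ^+ 2 + Im z ^+ 2 - 1)
   - N * q * q + q ^+ 2 * ((Re z - Re D.1) ^+ 2 + (Im z - Im D.1) ^+ 2))).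
  by rewrite S1z -NE subrr; ring.
by rewrite /q; field; rewrite gt_eqF.
Qed.

End PlaneGeometry.

(** * The topology of the plane and of the unit circle *)

Section PlaneTopology.
Variable R : realType.
Implicit Types (z : Cplx R).

Lemma norm_modulus z : `|z| = (modulus z)%:C.
Proof. by case: z. Qed.

Lemma nbhs_modulusP z (A : set (Cplx R)) :
  nbhs z A <-> exists2 e : R, 0 < e & forall y, modulus (z - y) < e -> A y.
Proof.
have -> : nbhs z A <-> nbhs_ball z A by split=> h; apply/nbhs_ballP.
split.
  move=> [[e e'] /=]; rewrite ltcE /= => /andP[/eqP e'0 e0] sub; exists e => // y zy.
  apply: sub; rewrite -ball_normE /= norm_modulus ltcE /= e'0 eqxx /=.
  exact: zy.
move=> [e e0 sub]; exists e%:C => /=; first by rewrite ltcR.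
move=> y; rewrite -ball_normE /= norm_modulus ltcR; exact: sub.
Qed.

Lemma cdisk_closed (P : Cplx R * R) : closed (cdisk P).
Proof.
rewrite -openC openE => z /= zP; apply/nbhs_modulusP.
have h : P.2 < modulus (z - P.1) by rewrite ltNge; apply/negP.
exists (modulus (z - P.1) - P.2); first by rewrite subr_gt0.
move=> y zy yP; have := modulus_dist_triangle z y P.1; move: yP; rewrite /cdisk /=; lra.
Qed.

Lemma S1_closed : closed (S1 R).
Proof.
rewrite -openC openE => z /= zP; apply/nbhs_modulusP.
have h : 0 < `|modulus z - 1|.
  by rewrite normr_gt0 subr_eq0; apply/eqP => h; apply: zP; rewrite /S1 /circle /= subr0.
exists `|modulus z - 1| => // y zy; rewrite /S1 /circle /= subr0 => y1.
have h1 := modulus_dist_triangle z y 0; have h2 := modulus_dist_triangle y z 0.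
rewrite !subr0 (modulus_distC y z) in h1 h2.
move: zy; rewrite ltNge => /negP; apply; rewrite ler_norml; apply/andP; split; lra.
Qed.

Lemma finite_lt_bound (I : finType) (f : I -> R) (c : R) : (forall i, f i < c) ->
  exists2 m, m < c & forall i, f i <= m.
Proof.
move=> fc; exists (\big[Num.max/(c - 1)]_i f i).
  by apply: bigmax_lt => //; rewrite ltrBlDr ltrDl.
by move=> i; exact: le_bigmax.
Qed.

End PlaneTopology.

(** * Lipschitz and continuous functions on the unit circle *)

Section LipschitzFunctions.
Variable R : realType.
Implicit Types (f g : Cplx R -> R) (c : R).

Definition lipschitz_S1 g : Prop := exists2 c, 0 <= c &
  forall x y, S1 R x -> S1 R y -> `|g x - g y| <= c * modulus (x - y).

Definition continuous_S1 g : Prop := forall x e, S1 R x -> 0 < e ->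
  exists2 d, 0 < d & forall y, S1 R y -> modulus (x - y) < d -> `|g x - g y| < e.

Lemma lipschitz_S1_continuous_S1 g : lipschitz_S1 g -> continuous_S1 g.
Proof.
move=> [c c0 hc] x e Sx e0; have c1 : 0 < c + 1 by rewrite ltr_wpDl.
exists (e / (c + 1)); first exact: divr_gt0.
move=> y Sy xy; apply: le_lt_trans (hc _ _ Sx Sy) _.
rewrite ltr_pdivlMr // in xy; apply: le_lt_trans xy.
by rewrite mulrC ler_wpM2l ?modulus_ge0 // lerDl.
Qed.

Lemma S1_1 : S1 R 1.
Proof. by rewrite S1E; exact: ComplexField.Normc.normc1. Qed.

Lemma S1_diam x y : S1 R x -> S1 R y -> modulus (x - y) <= 2.
Proof.
rewrite !S1E => x1 y1; have := modulusD x (- y); rewrite modulusN x1 y1; lra.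
Qed.

Lemma lipschitz_S1_bounded g : lipschitz_S1 g ->
  exists2 M, 0 <= M & forall x, S1 R x -> `|g x| <= M.
Proof.
move=> [c c0 hc]; exists (`|g 1| + c * 2); first by rewrite addr_ge0 // mulr_ge0.
move=> x Sx; have := hc x 1 Sx S1_1; have := ler_normD (g x - g 1) (g 1).
have := ler_wpM2l c0 (S1_diam Sx S1_1); rewrite subrK; lra.
Qed.

Lemma lipschitz_S1_const c : lipschitz_S1 (fun=> c).
Proof. by exists 0 => // x y _ _; rewrite subrr normr0 mul0r. Qed.

Lemma lipschitz_S1_sub f g : lipschitz_S1 f -> lipschitz_S1 g ->
  lipschitz_S1 (fun x => f x - g x).
Proof.
move=> [c c0 hc] [d d0 hd]; exists (c + d); first exact: addr_ge0.
move=> x y Sx Sy; have -> : f x - g x - (f y - g y) = (f x - f y) - (g x - g y) by ring.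
by rewrite mulrDl; apply: le_trans (ler_normB _ _) _; apply: lerD; [exact: hc | exact: hd].
Qed.

Lemma lipschitz_S1_mul f g : lipschitz_S1 f -> lipschitz_S1 g ->
  lipschitz_S1 (fun x => f x * g x).
Proof.
move=> hf hg; have [M M0 hM] := lipschitz_S1_bounded hf.
have [N N0 hN] := lipschitz_S1_bounded hg.
have [c c0 hc] := hf; have [d d0 hd] := hg; exists (c * N + M * d).
  by rewrite addr_ge0 // mulr_ge0.
move=> x y Sx Sy.
have -> : f x * g x - f y * g y = (f x - f y) * g x + f y * (g x - g y) by ring.
apply: le_trans (ler_normD _ _) _; rewrite !normrM mulrDl.
rewrite mulrAC -[M * d * _]mulrA; apply: lerD; apply: ler_pM => //.
- exact: hc.
- exact: hN.
- exact: hM.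
- exact: hd.
Qed.

Lemma lipschitz_S1_sum (I : finType) (F : I -> Cplx R -> R) :
  (forall i, lipschitz_S1 (F i)) -> lipschitz_S1 (fun x => \sum_i F i x).
Proof.
move=> hF; have {}hF i : {c | 0 <= c /\
    forall x y, S1 R x -> S1 R y -> `|F i x - F i y| <= c * modulus (x - y)}.
  apply: cid; have [c c0 hc] := hF i; by exists c.
exists (\sum_i sval (hF i)).
  by apply: sumr_ge0 => i _; case: (hF i) => c [].
move=> x y Sx Sy; rewrite -sumrB mulr_suml; apply: le_trans (ler_norm_sum _ _ _) _.
by apply: ler_sum => i _; case: (hF i) => c [c0 hc] /=; exact: hc.
Qed.

Lemma lipschitz_S1_comp g (h : Cplx R -> Cplx R) c : lipschitz_S1 g -> 0 <= c ->
  (forall x, S1 R x -> S1 R (h x)) ->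
  (forall x y, S1 R x -> S1 R y -> modulus (h x - h y) <= c * modulus (x - y)) ->
  lipschitz_S1 (g \o h).
Proof.
move=> [d d0 hd] c0 hS hh; exists (d * c); first exact: mulr_ge0.
move=> x y Sx Sy /=; apply: le_trans (hd _ _ (hS _ Sx) (hS _ Sy)) _.
by rewrite -mulrA ler_wpM2l // hh.
Qed.

(** S^1 having diameter 2, g is at most M = exp (2 K) g 1; and
    exp t - 1 <= t exp t. *)
Lemma lipschitz_S1_log_lip g K : 0 <= K -> (forall x, S1 R x -> 0 <= g x) ->
  (forall x y, S1 R x -> S1 R y -> g x <= expR (K * modulus (x - y)) * g y) ->
  lipschitz_S1 g.
Proof.
move=> K0 g0 gK; pose M := expR (K * 2) * g 1.
have gM x : S1 R x -> 0 <= g x <= M.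
  move=> Sx; rewrite g0 //=; apply: le_trans (gK x 1 Sx S1_1) _.
  by rewrite ler_wpM2r ?g0 ?ler_expR ?ler_wpM2l ?S1_diam //; exact: S1_1.
have M0 : 0 <= M by have /andP[] := gM _ S1_1; exact: le_trans.
move: M gM M0 => M gM M0; exists (M * (K * expR (2 * K))); first by rewrite !mulr_ge0 // expR_ge0.
have half x y : S1 R x -> S1 R y -> g x - g y <= M * (K * expR (2 * K)) * modulus (x - y).
  move=> Sx Sy; have := gK x y Sx Sy; set t := K * modulus (x - y) => h.
  have t0 : 0 <= t by rewrite mulr_ge0 // modulus_ge0.
  have /andP[gy0 gyM] := gM _ Sy.
  have t2 : expR t <= expR (2 * K).
    by rewrite ler_expR [2 * K]mulrC ler_wpM2l // S1_diam.
  have et : expR t - 1 <= t * expR t.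
    have := expR_ge1Dx (- t); rewrite expRN => h1.
    have h2 := ler_wpM2r (expR_ge0 t) h1; rewrite mulVf ?gt_eqF ?expR_gt0 // in h2.
    by rewrite mulrDl mul1r mulNr in h2; lra.
  apply: (@le_trans _ _ ((expR t - 1) * g y)); first by rewrite mulrBl mul1r lerD2r.
  apply: (@le_trans _ _ (t * expR (2 * K) * M)).
    apply: ler_pM => //; first by rewrite subr_ge0 -expR0 ler_expR.
    by apply: le_trans et _; rewrite ler_wpM2l.
  by rewrite /t le_eqVlt; apply/orP; left; apply/eqP; ring.
move=> x y Sx Sy; rewrite ler_norml; apply/andP; split; last exact: half.
by rewrite lerNl opprB (modulus_distC x); exact: half.
Qed.

Lemma lipschitz_S1_subC f c : lipschitz_S1 f -> lipschitz_S1 (fun x => f x - c).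
Proof. by move=> fl; apply: lipschitz_S1_sub => //; exact: lipschitz_S1_const. Qed.

Lemma lipschitz_S1_continuous f : lipschitz_S1 f ->
  {within S1 R, continuous (fun z => (f z)%:C : Cplx R)}.
Proof.
move=> [c c0 hc]; apply/subspace_continuousP => x Sx.
apply/cvgrPdist_lt => e; rewrite ltcE /= => /andP[/eqP e2 e0].
rewrite near_withinE; apply/nbhs_modulusP.
exists (complex.Re e / (c + 1)); first by rewrite divr_gt0 // ltr_wpDl.
move=> y xy Sy; rewrite -rmorphB /= norm_modulus modulus_real ltcE /= e2 eqxx /=.
apply: le_lt_trans (hc _ _ Sx Sy) _.
rewrite ltr_pdivlMr ?ltr_wpDl // in xy; apply: le_lt_trans xy.
by rewrite mulrC ler_wpM2l ?modulus_ge0 // lerDl.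
Qed.

End LipschitzFunctions.

Section UniformContinuity.
Variable R : realType.
Implicit Types (f g : Cplx R -> R) (z : Cplx R).

Lemma S1_cis z : S1 R z -> exists2 t : R, -pi <= t <= pi & cis t = z.
Proof.
case: z => x y /S1_sqr /= xy.
have x1 : -1 <= x <= 1.
  rewrite -ler_norml -(@ler_pXn2r _ 2) ?nnegrE // expr1n real_normK ?num_real //.
  by have := sqr_ge0 y; lra.
have sq : Num.sqrt (1 - x ^+ 2) = `|y|.
  by rewrite -sqrtr_sqr; congr Num.sqrt; lra.
have a0 := acos_ge0 x1; have api := acos_lepi x1.
have cx : cos (acos x) = x by rewrite acosK // in_itv.
have [y0|y0] := lerP 0 y.
  exists (acos x); first by apply/andP; split=> //; have := pi_ge0 R; lra.
  by rewrite /cis cx sin_acos // sq ger0_norm.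
exists (- acos x); first by apply/andP; split; have := pi_ge0 R; lra.
by rewrite /cis cosN sinN cx sin_acos // sq ltr0_norm // opprK.
Qed.

Lemma cis_continuous : continuous (fun t : R => cis t : Cplx R).
Proof.
move=> t; apply/cvgrPdist_lt => e; rewrite ltcE /= => /andP[/eqP e2 e0].
have e02 : 0 < complex.Re e / 2 by rewrite divr_gt0.
have /cvgrPdist_lt/(_ _ e02) hc := @continuous_cos R t.
have /cvgrPdist_lt/(_ _ e02) hs := @continuous_sin R t.
have eE : e = (complex.Re e)%:C by apply/eqP; rewrite eq_complex /= e2 !eqxx.
near=> u; rewrite norm_modulus eE ltcR.
have h1 : `|cos t - cos u| < complex.Re e / 2 by near: u.
have h2 : `|sin t - sin u| < complex.Re e / 2 by near: u.
apply: le_lt_trans (modulus_le_ReIm _) _ => /=.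
lra.
Unshelve. all: by end_near.
Qed.

Lemma S1_compact : compact (S1 R).
Proof.
have -> : S1 R = (fun t : R => cis t : Cplx R) @` `[-pi, pi].
  apply/seteqP; split=> [z Sz|_ [t _ <-]].
    by have [t tpi <-] := S1_cis Sz; exists t => //=; rewrite in_itv.
  by apply: sqr_S1; rewrite /= cos2Dsin2.
apply: continuous_compact; last exact: segment_compact.
by apply: continuous_subspaceT; exact: cis_continuous.
Qed.

(** Compactness in its near-covering form: the required d is found locally, and
    then near 0^'+ it serves all points at once. *)
Lemma continuous_S1_uniform f : continuous_S1 f -> forall e, 0 < e ->
  exists2 d, 0 < d & forall x y, S1 R x -> S1 R y -> modulus (x - y) < d ->
    `|f x - f y| < e.
Proof.
move=> fc e e0.
have : \forall d \near 0^'+, S1 R `<=` [set x | S1 R x -> forall y, S1 R y ->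
    modulus (x - y) < d -> `|f x - f y| < e].
  apply: (compact_near_coveringP (S1 R)).1; first exact: S1_compact.
  move=> x Sx; have [r r0 hr] := fc x (e / 2) Sx (divr_gt0 e0 (ltr0n _ 2)).
  exists ([set y | modulus (x - y) < r / 2], [set d | 0 < d < r / 2]) => /=.
    split; first by apply/nbhs_modulusP; exists (r / 2) => //; exact: divr_gt0.
    near=> d; apply/andP; split; first by near: d; exact: nbhs_right_gt.
    by near: d; apply: nbhs_right_lt; exact: divr_gt0.
  move=> [y d] /= [xy /andP[d0 dr]] Sy y' Sy' yy'.
  have h2 : modulus (x - y') < r by have := modulus_dist_triangle x y y'; lra.
  have h3 : modulus (x - y) < r by lra.
  have := hr y' Sy' h2; have := hr y Sy h3.
  have := ler_normD (f y - f x) (f x - f y'); rewrite addrA subrK (distrC (f y) (f x)); lra.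
move=> hd.
have [d [d0 hd']] : exists d, 0 < d /\ S1 R `<=` [set x | S1 R x -> forall y, S1 R y ->
    modulus (x - y) < d -> `|f x - f y| < e].
  near (0:R)^'+ => d; exists d; split; first by near: d; exact: nbhs_right_gt.
  by near: d.
by exists d => // x y Sx Sy; exact: (hd' x Sx Sx).
Unshelve. all: by end_near.
Qed.

Lemma continuous_S1_bounded f : continuous_S1 f ->
  exists2 M, 0 <= M & forall x, S1 R x -> `|f x| <= M.
Proof.
move=> fc.
have : \forall M \near +oo, S1 R `<=` [set x | S1 R x -> `|f x| <= M].
  apply: (compact_near_coveringP (S1 R)).1; first exact: S1_compact.
  move=> x Sx; have [r r0 hr] := fc x 1 Sx ltr01.
  exists ([set y | modulus (x - y) < r], [set M | `|f x| + 1 < M]) => /=.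
    split; first by apply/nbhs_modulusP; exists r.
    by apply: nbhs_pinfty_gt; exact: num_real.
  move=> [y M] /= [xy hM] Sy; have := hr y Sy xy.
  have := ler_normB (f x) (f x - f y); rewrite opprB addrC subrK; lra.
move=> hM.
have [M [M0 hM']] : exists M, 0 <= M /\ S1 R `<=` [set x | S1 R x -> `|f x| <= M].
  near (+oo : set_system R) => M; exists M; split; last by near: M.
  by near: M; apply: nbhs_pinfty_ge; exact: num_real.
by exists M => // x Sx; exact: (hM' x Sx Sx).
Unshelve. all: by end_near.
Qed.

(** The inf-convolution h of f with n |x - y| is n-Lipschitz and below f.  For
    n = 2 M / d, where |f| <= M, points y farther than d from x give values above
    f x, so h x is governed by the points where f y is close to f x. *)
Lemma lipschitz_S1_dense f eta : continuous_S1 f -> 0 < eta ->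
  exists2 h, lipschitz_S1 h & forall x, S1 R x -> `|f x - h x| <= eta.
Proof.
move=> fc eta0; have [M M0 hM] := continuous_S1_bounded fc.
have [d d0 hd] := continuous_S1_uniform fc eta0.
pose n := 2 * M / d; have n0 : 0 <= n by rewrite divr_ge0 ?mulr_ge0 // ltW.
pose V x := [set f y + n * modulus (x - y) | y in S1 R].
have V0 x : V x !=set0 by exists (f 1 + n * modulus (x - 1)), 1 => //; exact: S1_1.
have Vlb x : has_lbound (V x).
  exists (- M) => _ [y Sy <-]; have := hM y Sy; rewrite ler_norml => /andP[h _].
  by apply: le_trans h _; rewrite lerDl mulr_ge0 ?modulus_ge0.
have infV x : has_inf (V x) by split.
pose h x := inf (V x).
have hle x y : S1 R y -> h x <= f y + n * modulus (x - y).
  by move=> Sy; apply: ge_inf => //; exists y.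
exists h.
  exists n => // x x' _ _.
  have half y y' : h y - h y' <= n * modulus (y - y').
    rewrite lerBlDl -lerBlDr; apply: lb_le_inf => // _ [u Su <-].
    rewrite lerBlDr; apply: le_trans (hle y u Su) _.
    have := ler_wpM2l n0 (modulus_dist_triangle y y' u); lra.
  by rewrite ler_norml half andbT lerNl opprB modulus_distC half.
move=> x Sx; rewrite ler_norml; apply/andP; split.
  have := hle x x Sx; rewrite subrr modulus0 mulr0 addr0; lra.
rewrite lerBlDl -lerBlDr; apply: lb_le_inf => // _ [y Sy <-].
have [xy|xy] := ltP (modulus (x - y)) d.
  have := hd x y Sx Sy xy; have := ler_norm (f x - f y).
  have : 0 <= n * modulus (x - y) by rewrite mulr_ge0 ?modulus_ge0.
  lra.
have : 2 * M <= n * modulus (x - y).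
  by rewrite /n -mulrA ler_peMr ?mulr_ge0 // mulrC ler_pdivlMr // mul1r.
have := hM x Sx; have := hM y Sy; rewrite !ler_norml => /andP[? ?] /andP[? ?]; lra.
Qed.

End UniformContinuity.

(** * Integrals over the unit circle *)

Section Integrals.
Variable R : realType.
Implicit Types (f g : Cplx R -> R) (mu : probability (borelC R) R) (A : set (Cplx R)).

Lemma closed_borelC A : closed A -> measurable (A : set (borelC R)).
Proof.
move=> cA; rewrite -(setCK A); apply: measurableC.
by apply: sub_sigma_algebra; exact: closed_openC.
Qed.

Lemma continuous_S1_measurable A g : closed A -> A `<=` S1 R -> continuous_S1 g ->
  measurable_fun (A : set (borelC R)) g.
Proof.
move=> cA AS gc; apply: (measurability _ (RGenCInfty.measurableE R)).
move=> _ [_ [a ->] <-]; apply: closed_borelC.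
rewrite -openC openE => z /= zP; apply/nbhs_modulusP.
have [Az|nAz] := pselect (A z); last first.
  have /nbhs_modulusP[e e0 he] : nbhs z (~` A).
    by apply: open_nbhs_nbhs; split=> //; exact: closed_openC.
  by exists e => // y zy [Ay _]; exact: (he y zy).
have gz : g z < a.
  by rewrite ltNge; apply/negP => h; apply: zP; split=> //=; rewrite in_itv /= andbT.
have [e e0 he] : exists2 e, 0 < e & forall y, S1 R y -> modulus (z - y) < e ->
    `|g z - g y| < a - g z by apply: gc; [exact: AS | rewrite subr_gt0].
exists e => // y zy [Ay]; rewrite /= in_itv /= andbT => ay.
have := he y (AS _ Ay) zy; rewrite distrC; have := ler_norm (g y - g z); lra.
Qed.

Lemma continuous_S1_integrable mu A g : closed A -> A `<=` S1 R -> continuous_S1 g ->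
  (exists2 M, 0 <= M & forall x, S1 R x -> `|g x| <= M) ->
  mu.-integrable (A : set (borelC R)) (EFin \o g).
Proof.
move=> cA AS gc [M M0 hM]; apply: measurable_bounded_integrable.
- exact: closed_borelC.
- by apply: le_lt_trans (ltry 1); apply: probability_le1; exact: closed_borelC.
- exact: continuous_S1_measurable.
- exists M; split; first exact: num_real.
  by move=> x Mx y Ay /=; apply: le_trans (ltW Mx); apply: hM; exact: AS.
Qed.

Lemma lipschitz_integrable mu A g : closed A -> A `<=` S1 R -> lipschitz_S1 g ->
  mu.-integrable (A : set (borelC R)) (EFin \o g).
Proof.
move=> cA AS gl; apply: continuous_S1_integrable => //.
  exact: lipschitz_S1_continuous_S1.
exact: lipschitz_S1_bounded.
Qed.

Lemma Rintegral_dist_le mu f g (eta : R) : 0 <= eta -> continuous_S1 f -> continuous_S1 g ->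
  (exists2 M, 0 <= M & forall x, S1 R x -> `|f x| <= M) ->
  (exists2 M, 0 <= M & forall x, S1 R x -> `|g x| <= M) ->
  (forall x, S1 R x -> `|f x - g x| <= eta) ->
  `|\int[mu]_(x in S1 R) f x - \int[mu]_(x in S1 R) g x| <= eta.
Proof.
move=> eta0 fc gc fb gb fg; have cS := @S1_closed R.
have mS : measurable (S1 R : set (borelC R)) by exact: closed_borelC.
have intf : mu.-integrable (S1 R : set (borelC R)) (EFin \o f).
  exact: continuous_S1_integrable.
have intg : mu.-integrable (S1 R : set (borelC R)) (EFin \o g).
  exact: continuous_S1_integrable.
have intc : mu.-integrable (S1 R : set (borelC R)) (EFin \o (fun=> eta)).
  by apply: lipschitz_integrable => //; exact: lipschitz_S1_const.
have half (f1 f2 : Cplx R -> R) :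
    mu.-integrable (S1 R : set (borelC R)) (EFin \o f1) ->
    mu.-integrable (S1 R : set (borelC R)) (EFin \o f2) ->
    (forall x, S1 R x -> `|f1 x - f2 x| <= eta) ->
    \int[mu]_(x in S1 R) f1 x - \int[mu]_(x in S1 R) f2 x <= eta.
  move=> int1 int2 f12.
  apply: (@le_trans _ _ (\int[mu]_(x in S1 R) eta)); last first.
    rewrite Rintegral_cst // ler_piMr // -[leRHS]/(fine 1%E) fine_le ?fin_num_measure //.
    exact: probability_le1.
  rewrite -RintegralB //; apply: le_Rintegral => //.
    exact: (integrableB mS int1 int2).
  by move=> x Sx; apply: le_trans (ler_norm _) (f12 x Sx).
rewrite ler_norml half // andbT lerNl opprB half // => x Sx.
by rewrite distrC fg.
Qed.

End Integrals.

Section AtomicIntegral.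
Variables (R : realType) (nu : probability (borelC R) R) (M : nat).
Variables (w : 'I_M.+1 -> R) (z : 'I_M.+1 -> Cplx R).
Hypotheses (w0 : forall l, 0 <= w l) (w1 : \sum_l w l = 1) (zS : forall l, S1 R (z l)).
Hypothesis nuE : forall A : set (borelC R), measurable A ->
  nu A = (\sum_l (w l)%:E * \d_(z l : borelC R) A)%E.

Let atom (n : nat) : {measure set (borelC R) -> \bar R} :=
  mscale (NngNum (w0 (inord n))) (@dirac _ (borelC R) (z (inord n)) R).

Let mS1 : measurable (S1 R : set (borelC R)).
Proof. exact: (closed_borelC (@S1_closed R)). Qed.

Lemma atomic_integral_ge0 (g : Cplx R -> R) : lipschitz_S1 g ->
  (forall x, S1 R x -> 0 <= g x) ->
  (\int[nu]_(x in S1 R) (g x)%:E)%E = (\sum_l w l * g (z l))%:E.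
Proof.
move=> gl g0.
have mg : measurable_fun (S1 R : set (borelC R)) (fun x : borelC R => (g x)%:E).
  apply/measurable_EFinP; apply: continuous_S1_measurable => //.
    exact: S1_closed.
  exact: lipschitz_S1_continuous_S1.
rewrite (@eq_measure_integral _ (borelC R) R (S1 R) (msum atom M.+1)); last first.
  move=> A mA _; apply: (eq_trans (nuE mA)); rewrite /msum /=; apply: eq_bigr => l _.
  by rewrite /mscale /= inord_val.
rewrite ge0_integral_measure_sum //=.
rewrite -sumEFin; apply: eq_bigr => l _.
rewrite ge0_integral_mscale //=.
rewrite integral_dirac //= inord_val.
have zin : z l \in S1 R by rewrite inE; exact: zS.
by rewrite diracE zin mul1e EFinM.
Qed.

Lemma atomic_Rintegral (g : Cplx R -> R) : lipschitz_S1 g ->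
  \int[nu]_(x in S1 R) g x = \sum_l w l * g (z l).
Proof.
move=> gl; have [B B0 hB] := lipschitz_S1_bounded gl.
have gB : lipschitz_S1 (fun x => g x - (- B)) by exact: lipschitz_S1_subC.
have gB0 x : S1 R x -> 0 <= g x - - B.
  by move=> Sx; have := hB x Sx; rewrite ler_norml => /andP[]; lra.
have := congr1 fine (atomic_integral_ge0 gB gB0).
rewrite -/(Rintegral _ _ _) /= RintegralB //; first last.
- apply: lipschitz_integrable; [exact: S1_closed | by [] | exact: lipschitz_S1_const].
- by apply: lipschitz_integrable => //; exact: S1_closed.
have c1 : (\int[nu]_(x in S1 R) (1%:E : \bar R))%E = 1%:E.
  have := @atomic_integral_ge0 (fun=> 1) (lipschitz_S1_const _) (fun _ _ => ler01).
  by under [in RHS]eq_bigr do rewrite mulr1; rewrite w1.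
have -> : \int[nu]_(x in S1 R) - B = - B.
  rewrite Rintegral_cst //; move: c1; rewrite integral_cst // mul1e => -> /=.
  by rewrite mulr1.
have -> : \sum_l w l * (g (z l) - - B) = \sum_l w l * g (z l) - - B.
  by under eq_bigr do rewrite mulrBr; rewrite sumrB -mulr_suml w1 mul1r.
by move/addIr.
Qed.

End AtomicIntegral.

Section LimitMeasureIntegral.
Variables (R : realType) (k : nat) (D : 'I_k.+1 -> Cplx R * R).
Variables (mu : probability (borelC R) R).
Hypothesis mu0 : mu (~` limit_set D) = 0%E.

Lemma limit_set_closed : closed (limit_set D).
Proof. by apply: closedI; [exact: closed_closure | exact: S1_closed]. Qed.

Let mL : measurable (limit_set D : set (borelC R)).
Proof. exact: (closed_borelC limit_set_closed). Qed.

Lemma limit_set_S1 : limit_set D `<=` S1 R. Proof. by move=> x []. Qed.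

(** Integrating over the limit set rather than S^1 makes pointwise comparisons on
    the limit set sufficient. *)
Definition limit_mean (g : Cplx R -> R) : R := \int[mu]_(x in limit_set D) g x.

Lemma limit_meanE g : lipschitz_S1 g -> \int[mu]_(x in S1 R) g x = limit_mean g.
Proof.
move=> gl; rewrite /limit_mean /Rintegral; congr fine.
have mS1 : measurable (S1 R : set (borelC R)).
  exact: (closed_borelC (@S1_closed R)).
rewrite (@negligible_integral _ (borelC R) R mu (S1 R) (~` limit_set D)) //.
- congr (integral _ _ _); rewrite setDE setCK; apply/seteqP; split=> x; first by case.
  by move=> Lx; split=> //; exact: limit_set_S1.
- exact: measurableC.
- by apply: lipschitz_integrable => //; exact: S1_closed.
Qed.

Let int g : lipschitz_S1 g -> mu.-integrable (limit_set D : set (borelC R)) (EFin \o g).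
Proof. by apply: lipschitz_integrable; [exact: limit_set_closed | exact: limit_set_S1]. Qed.

Lemma limit_mean_const c : limit_mean (fun=> c) = c.
Proof.
have muL : mu (limit_set D) = 1%E.
  have := probability_setC mu mL; rewrite mu0 => /esym/eqP.
  by rewrite sube_eq ?add0e ?fin_num_measure // => /eqP.
rewrite /limit_mean Rintegral_cst // -[RHS]mulr1.
by congr (_ * _); apply: (congr1 fine muL).
Qed.

Lemma limit_mean_sub f g : lipschitz_S1 f -> lipschitz_S1 g ->
  limit_mean (fun x => f x - g x) = limit_mean f - limit_mean g.
Proof. by move=> fl gl; rewrite /limit_mean RintegralB //; exact: int. Qed.

Lemma limit_mean_le f g : lipschitz_S1 f -> lipschitz_S1 g ->
  (forall x, limit_set D x -> f x <= g x) -> limit_mean f <= limit_mean g.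
Proof. by move=> fl gl fg; apply: le_Rintegral => //; exact: int. Qed.

Lemma limit_mean_eq f g : (forall x, limit_set D x -> f x = g x) ->
  limit_mean f = limit_mean g.
Proof. by move=> fg; apply: eq_Rintegral => x; rewrite inE; exact: fg. Qed.

Lemma limit_mean_sum (I : finType) (F : I -> Cplx R -> R) :
  (forall i, lipschitz_S1 (F i)) ->
  limit_mean (fun x => \sum_i F i x) = \sum_i limit_mean (F i).
Proof.
move=> Fl.
have h (s : seq I) : lipschitz_S1 (fun x => \sum_(i <- s) F i x) /\
    limit_mean (fun x => \sum_(i <- s) F i x) = \sum_(i <- s) limit_mean (F i).
  elim: s => [|i s [IHl IH]].
    rewrite big_nil -[RHS](limit_mean_const 0); split.
      by under eq_fun do rewrite big_nil; exact: lipschitz_S1_const.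
    by congr limit_mean; apply/funext => x; rewrite big_nil.
  have e : (fun x => \sum_(j <- i :: s) F j x) =
      (fun x => F i x - (0 - \sum_(j <- s) F j x)).
    by apply/funext => x; rewrite big_cons sub0r opprK.
  have l0 : lipschitz_S1 (fun x => 0 - \sum_(j <- s) F j x).
    by apply: lipschitz_S1_sub => //; exact: lipschitz_S1_const.
  rewrite e; split; first exact: lipschitz_S1_sub.
  rewrite limit_mean_sub // limit_mean_sub //; last exact: lipschitz_S1_const.
  by rewrite limit_mean_const IH big_cons sub0r opprK.
by have [_ <-] := h (index_enum I).
Qed.

End LimitMeasureIntegral.

(** * Cells and McMullen's list *)

Section Cells.
Variables (R : realType) (k : nat) (D : 'I_k.+1 -> Cplx R * R).
Hypothesis hD : disjoint_geodesic_disks D.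
Local Notation I := 'I_k.+1.
Local Notation rho := (reflection D).

Lemma primitive_normal l : normal_to_S1 (D l).
Proof. by case: hD => h0 ho _; exact: orthogonal_unit_normal. Qed.

Let D_gt0 l : 0 < (D l).2. Proof. by case: (primitive_normal l). Qed.

Lemma primitive_eq l l' x : cdisk (D l) x -> cdisk (D l') x -> l = l'.
Proof.
by case: hD => _ _ tD Dl Dl'; apply: (tD l l' Logic.I Logic.I); exists x; split.
Qed.

Lemma reflectionK l : involutive (rho l).
Proof. by apply: inversionK; exact: lt0r_neq0. Qed.

Lemma reflection_center l : rho l (D l).1 = (D l).1.
Proof. by rewrite /reflection /inversion subrr conjc0 invr0 mulr0 addr0. Qed.

Lemma outside_primitive s t x : s != t -> cdisk (D t) x ->
  (D s).2 < modulus (x - (D s).1).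
Proof.
move=> st Dtx; rewrite ltNge; apply/negP => h.
by move/eqP: st; apply; exact: (@primitive_eq s t x).
Qed.

Lemma reflection_maps s t x : s != t -> cdisk (D t) x -> cdisk (D s) (rho s x).
Proof. by move=> st Dtx; apply: inversion_cdisk => //; apply/ltW/(outside_primitive st). Qed.

Lemma subdisk_far s t Q : s != t -> 0 < Q.2 -> cdisk Q `<=` cdisk (D t) ->
  (D s).2 + Q.2 < modulus (Q.1 - (D s).1).
Proof.
move=> st Q0 Qt; rewrite modulus_distC; apply: cdisk_disjoint => //.
rewrite -subset0 => x [Dsx Qx]; move/eqP: st; apply; apply: primitive_eq Dsx _; exact: Qt.
Qed.

(** For a reduced word s_1 ... s_n this is the cell rho_(s_1) ... rho_(s_(n-1))(D_(s_n)),
    described by the itinerary of its points: inclusion and disjointness of cells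
    become statements about prefixes.  The empty word stands for the plane, so
    that a word of one letter gives a primitive disk. *)
Fixpoint itinerary_set (u : seq I) : set (Cplx R) :=
  if u is s :: v then cdisk (D s) `&` rho s @^-1` itinerary_set v else setT.

Definition reduced (u : seq I) : bool := sorted (fun s t => s != t) u.

Lemma itinerary_set_catl u v : itinerary_set (u ++ v) `<=` itinerary_set u.
Proof. by elim: u => //= s u IH x [Dx ux]; split=> //; exact: IH. Qed.

Lemma itinerary_set_comparable u v x : itinerary_set u x -> itinerary_set v x ->
  (size u <= size v)%N -> exists w, v = u ++ w.
Proof.
elim: u v x => [|s u IH] [|t v] x //=; first by exists [::].
  by exists (t :: v).
move=> [Ds us] [Dt vs] uv; have st := primitive_eq Ds Dt; subst t.
by have [w ->] := IH _ _ us vs uv; exists w.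
Qed.

Lemma reduced_tail s u : reduced (s :: u) -> reduced u.
Proof. by case: u => //= t u /andP[]. Qed.

Lemma reflection_image s t (A : set (Cplx R)) : s != t -> A `<=` cdisk (D t) ->
  rho s @` A = cdisk (D s) `&` rho s @^-1` A.
Proof.
move=> st At; apply/seteqP; split=> [_ [x Ax <-]|x [Dx Ax]].
  by split=> /=; [exact: reflection_maps (At _ Ax) | rewrite reflectionK].
by exists (rho s x) => //; rewrite reflectionK.
Qed.

(** By induction the cell of the tail is a disk inside D_t with t <> s, so the
    centre of D_s is outside it and its reflection in D_s is again a disk. *)
Lemma reduced_itinerary_cell s u : reduced (s :: u) ->
  exists P, [/\ cells D (size u) P, cdisk P = itinerary_set (s :: u) & normal_to_S1 P].
Proof.
elim: u s => [|t u IH] s.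
  move=> _; exists (D s); split; [by exists s | | exact: primitive_normal].
  by rewrite /= preimage_setT setIT.
move=> /= /andP[st tu]; have [Q [cQ eQ nQ]] := IH t tu.
have Qt : cdisk Q `<=` cdisk (D t) by rewrite eQ => x [].
have far := subdisk_far st nQ.1 Qt.
have far' : Q.2 < modulus (Q.1 - (D s).1) by apply: le_lt_trans far; rewrite lerDr ltW.
exists (invert_disk (D s) Q).
have im : cdisk (invert_disk (D s) Q) = rho s @` cdisk Q.
  by rewrite /reflection inversion_disk // ltW // nQ.1.
split.
- exists s, Q; split=> // /(_ Q.1 (cdisk_center (ltW nQ.1))) h.
  by move/eqP: st; apply; apply: primitive_eq h _; apply/Qt/cdisk_center/ltW; exact: nQ.1.
- by rewrite im (reflection_image st Qt) eQ.
- exact: invert_disk_normal (primitive_normal s) nQ far'.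
Qed.

Lemma cell_itinerary n P : cells D n P -> exists s u,
  [/\ reduced (s :: u), size u = n, cdisk P = itinerary_set (s :: u) & normal_to_S1 P].
Proof.
elim: n P => [|n IH] P /=.
  case=> s _ <-; exists s, [::]; split=> //; last exact: primitive_normal.
  by rewrite /= preimage_setT setIT.
move=> [s [Q [cQ nsub eP]]]; have [t [u [ru su eQ nQ]]] := IH _ cQ.
have Qt : cdisk Q `<=` cdisk (D t) by rewrite eQ => x [].
have st : s != t by apply/eqP => st; apply: nsub; rewrite st.
have rs : reduced (s :: t :: u) by rewrite /= st.
have eP' : cdisk P = itinerary_set (s :: t :: u).
  by rewrite eP (reflection_image st Qt) eQ.
have [P' [_ eP'' nP']] := reduced_itinerary_cell rs.
exists s, (t :: u); split=> //; first by rewrite /= su.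
by rewrite -(@cdisk_inj _ P' P) ?eP'' ?eP' // ltW // nP'.1.
Qed.

Lemma cell_normal n P : cells D n P -> normal_to_S1 P.
Proof. by case/cell_itinerary => s [u []]. Qed.

(** The only obstacle is a word and a proper extension of it; there the centre of
    the last disk of the shorter word, a fixed point of the reflection in that
    disk, separates the two sets. *)
Lemma itinerary_set_inj u v : reduced u -> reduced v -> u != [::] -> v != [::] ->
  itinerary_set u = itinerary_set v -> u = v.
Proof.
elim: u v => [|s u IH] [|t v] // ru rv _ _ e.
have [P [_ eP nP]] := reduced_itinerary_cell ru.
have : itinerary_set (s :: u) P.1 by rewrite -eP; apply/cdisk_center/ltW; exact: nP.1.
move=> Px; have Px' := Px; rewrite e in Px'.
have st := primitive_eq Px.1 Px'.1; subst t; congr cons.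
have center w : reduced (s :: w) -> w != [::] -> ~ itinerary_set (s :: w) (D s).1.
  case: w => [|t w] //= /andP[st _] _ [_ []]; rewrite reflection_center => h _.
  by move/eqP: st; apply; apply: primitive_eq h; apply/cdisk_center/ltW.
have cs : cdisk (D s) (D s).1 by apply/cdisk_center/ltW.
have [u0|u0] := eqVneq u [::]; have [v0|v0] := eqVneq v [::].
- by rewrite u0 v0.
- by have := center v rv v0; rewrite -e u0 /= => /(_ (conj cs Logic.I)).
- by have := center u ru u0; rewrite e v0 /= => /(_ (conj cs Logic.I)).
have tl w w' : reduced (s :: w) -> w != [::] ->
    itinerary_set (s :: w) = itinerary_set (s :: w') -> itinerary_set w `<=` itinerary_set w'.
  case: w => // t w /= /andP[st _] _ e' y wy.
  have : (cdisk (D s) `&` rho s @^-1` itinerary_set w') (rho s y).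
    by rewrite -e'; split; [exact: (reflection_maps st wy.1) | rewrite /= reflectionK].
  by case=> _ /=; rewrite reflectionK.
apply: (IH _ (reduced_tail ru) (reduced_tail rv) u0 v0).
by apply/seteqP; split; [exact: (tl u v ru u0 e) | exact: (tl v u rv v0 (esym e))].
Qed.

Lemma same_generation_cells n P P' x : cells D n P -> cells D n P' ->
  cdisk P x -> cdisk P' x -> P = P'.
Proof.
move=> /cell_itinerary[s [u [_ su eP nP]]] /cell_itinerary[s' [u' [_ su' eP' nP']]] Px Px'.
apply: cdisk_inj; first exact: (ltW nP.1).
rewrite eP in Px; rewrite eP' in Px'.
have [|w e] := itinerary_set_comparable Px Px'; first by rewrite /= su su'.
have /eqP := congr1 size e.
rewrite size_cat /= su su' -[X in X == _]addn0 eqn_add2l eq_sym size_eq0 => /eqP w0.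
by rewrite eP eP' e w0 cats0.
Qed.

Lemma cell_generation n n' P : cells D n P -> cells D n' P -> n = n'.
Proof.
move=> /cell_itinerary[s [u [ru su eP nP]]] /cell_itinerary[s' [u' [ru' su' eP' _]]].
have [_ uu] : s :: u = s' :: u' by apply: itinerary_set_inj => //; rewrite -eP -eP'.
by rewrite -su -su' uu.
Qed.

Section List.
Variable eps : R.
Local Notation L m := (iter m (mcmullen_step D eps) (cells D 1)).

Lemma mcmullen_stage_cells m P : L m P -> exists n, cells D n.+1 P.
Proof.
elim: m P => [|m IH] P; first by exists 0%N.
by case=> [[/IH//]|[Q [/IH _ _] [n [_ cP _]]]]; exists n.
Qed.

(** Two intersecting members of the next stage have intersecting parents, which
    coincide by induction; children of one cell have the same generation, and
    cells of the same generation are equal or disjoint. *)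
Lemma mcmullen_stage_antichain m P P' x : L m P -> L m P' ->
  cdisk P x -> cdisk P' x -> P = P'.
Proof.
elim: m P P' => [|m IH] P P'; first exact: same_generation_cells.
have parent P1 : L m.+1 P1 -> exists Q, [/\ L m Q, cdisk P1 `<=` cdisk Q &
    (Q.2 < eps /\ P1 = Q) \/ (eps <= Q.2 /\ children D Q P1)].
  case=> [[LP Pe]|[Q [LQ Qe] cP]]; first by exists P1; split=> //; left.
  by exists Q; split=> //; [case: cP => n [] | right].
move=> /parent[Q [LQ PQ hQ]] /parent[Q' [LQ' PQ' hQ']] Px Px'.
have e := IH _ _ LQ LQ' (PQ _ Px) (PQ' _ Px'); subst Q'.
case: hQ hQ' => [[Qe ->]|[Qe [n [cQ cP _]]]] [[Qe' ->]|[Qe' [n' [cQ' cP' _]]]] //.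
- by move: (lt_le_trans Qe Qe'); rewrite ltxx.
- by move: (lt_le_trans Qe' Qe); rewrite ltxx.
rewrite (cell_generation cQ' cQ) in cP'.
exact: same_generation_cells cP cP' Px Px'.
Qed.

(** If the member P containing Q is subdivided then P is larger than Q, so the
    word of Q properly extends that of P and its next letter selects a child of P
    that contains Q. *)
Lemma mcmullen_stage_covers m n Q : cells D n.+1 Q -> Q.2 < eps ->
  exists2 P, L m P & cdisk Q `<=` cdisk P.
Proof.
move=> cQ Qe; have [s [u [ru su eQ nQ]]] := cell_itinerary cQ.
elim: m => [|m [P LP QP]].
  case: u su ru eQ => // t u _ /= /andP[st _] eQ.
  have [P [cP eP _]] := @reduced_itinerary_cell s [:: t] (etrans (andbT _) st).
  exists P => //; rewrite eQ eP; exact: (@itinerary_set_catl [:: s; t] u).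
have [Pe|Pe] := ltP P.2 eps; first by exists P => //; left.
have [n' cP] := mcmullen_stage_cells LP.
have [s' [u' [ru' su' eP nP]]] := cell_itinerary cP.
have Qc : cdisk Q Q.1 by apply/cdisk_center/ltW; exact: nQ.1.
have QP2 : Q.2 < P.2 by exact: lt_le_trans Pe.
have Pc := QP _ Qc; rewrite eQ in Qc; rewrite eP in Pc.
have [uu|uu] := leqP (size (s :: u)) (size (s' :: u')).
  have [w e] := itinerary_set_comparable Qc Pc uu.
  have PQ : cdisk P `<=` cdisk Q by rewrite eP eQ e; exact: itinerary_set_catl.
  have := @cdisk_inj _ P Q (ltW nP.1); rewrite (_ : cdisk P = cdisk Q).
    by move=> /(_ erefl) PQe; move: QP2; rewrite PQe ltxx.
  by apply/seteqP.
have [[|t w] e] := itinerary_set_comparable Pc Qc (ltnW uu).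
  by move: uu; rewrite e cats0 ltnn.
have rt : reduced (s' :: rcons u' t).
  by move: ru; rewrite e -cat_rcons; rewrite /reduced rcons_cons; case/cat_sorted2.
have [P' [cP' eP' _]] := reduced_itinerary_cell rt.
exists P'; last by rewrite eQ eP' e -cat_rcons; exact: itinerary_set_catl.
right; exists P; first by split.
exists n'.+1; split=> //; first by move: cP'; rewrite size_rcons su'.
by rewrite eP eP' -rcons_cons -cats1; exact: itinerary_set_catl.
Qed.

End List.

Section FinalList.
Variables (eps : R) (M : nat) (P : 'I_M.+1 -> Cplx R * R) (p : 'I_M.+1 -> I).
Hypotheses (hP : mcmullen_list D eps P) (hp : forall i, cdisk (P i) `<=` cdisk (D (p i))).

Lemma list_cell i : exists n, cells D n.+1 (P i).
Proof.
case: hP => _ _ [m rP]; apply: (@mcmullen_stage_cells eps m); rewrite -rP; by exists i.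
Qed.

Lemma list_normal i : normal_to_S1 (P i).
Proof. by have [n] := list_cell i; exact: cell_normal. Qed.

Lemma sample_point_in i : cdisk (P i) (sample_point P i) /\ S1 R (sample_point P i).
Proof. exact: radial_projection_cdisk (list_normal i). Qed.

(** A cell of positive generation in D_s is sent by rho_s into some D_t with
    t <> s, while P_j lies in D_s. *)
Lemma list_transition_diag i j : p i = p j -> ~ cdisk (P j) `<=` rho (p i) @` cdisk (P i).
Proof.
move=> pij sub; have [zj _] := sample_point_in j.
have [y Piy yz] := sub _ zj; have zD := hp zj.
have [n /cell_itinerary[s [[|t u] [ru // _ ePi _]]]] := list_cell i.
move: (Piy); rewrite ePi => -[Dy [Dty _]].
have sp : s = p i by apply: primitive_eq Dy _; exact: hp.
rewrite sp in ru Dty; move: ru => /= /andP[/eqP st _]; apply: st.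
by rewrite yz in Dty; apply: primitive_eq _ Dty; rewrite pij.
Qed.

(** rho_s(P_j) is a cell, smaller than P_j and hence than eps, so the list covers
    it, and by one member only. *)
Lemma list_transition_exists j s : s != p j -> exists i,
  [/\ p i = s, cdisk (P j) `<=` rho s @` cdisk (P i) &
      forall i', p i' = s -> cdisk (P j) `<=` rho s @` cdisk (P i') -> i' = i].
Proof.
move=> sp; have nj := list_normal j; have [n cj] := list_cell j.
have far := subdisk_far sp nj.1 (hp (i := j)).
have far' : (P j).2 < modulus ((P j).1 - (D s).1) by apply: le_lt_trans far; rewrite lerDr ltW.
set Q := invert_disk (D s) (P j).
have im : cdisk Q = rho s @` cdisk (P j) by rewrite /reflection inversion_disk // ltW // nj.1.
have cQ : cells D n.+2 Q.
  exists s, (P j); split=> // sub; move/eqP: sp; apply.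
  have c := cdisk_center (ltW nj.1).
  by apply: primitive_eq (sub _ c) _; exact: hp.
have Qe : Q.2 < eps.
  by apply: lt_trans (invert_disk_radius (D_gt0 s) nj.1 far) _; case: hP.
case: hP => Pinj _ [m rP].
have [P' LP' QP] := mcmullen_stage_covers m cQ Qe.
move: LP'; rewrite -rP => -[i _ ePi]; rewrite -ePi in QP.
have Qc : cdisk Q Q.1 by apply/cdisk_center/ltW; exact: (cell_normal cQ).1.
have sub i' : cdisk (P j) `<=` rho s @` cdisk (P i') <-> cdisk Q `<=` cdisk (P i').
  rewrite im; split=> h x.
    by case=> y Py <-; have [y' Py' <-] := h _ Py; rewrite reflectionK.
  by move=> Px; exists (rho s x); [apply: h; exists x | rewrite reflectionK].
exists i; split; last 1 first.
- move=> i' _ /sub QP'; apply: Pinj.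
  apply: (@mcmullen_stage_antichain eps m _ _ Q.1).
  + by rewrite -rP; exists i'.
  + by rewrite -rP; exists i.
  + exact: QP'.
  + exact: QP.
- apply: (@primitive_eq _ _ Q.1); first by apply/hp/QP.
  have : (rho s @` cdisk (P j)) Q.1 by rewrite -im.
  by case=> y Py <-; apply: reflection_maps sp _; exact: hp.
- exact/sub.
Qed.

Lemma list_transition_dist i j s : cdisk (P j) `<=` rho s @` cdisk (P i) ->
  modulus (sample_point P i - rho s (sample_point P j)) <= 2 * eps.
Proof.
move=> sub; have [zj _] := sample_point_in j; have [zi _] := sample_point_in i.
have [y Py <-] := sub _ zj; rewrite reflectionK.
apply: le_trans (modulus_dist_triangle _ (P i).1 _) _.
rewrite (modulus_distC _ y) mulrDl !mul1r.
have Pe : (P i).2 <= eps by apply: ltW; case: hP.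
by apply: lerD; apply: le_trans Pe.
Qed.

End FinalList.

End Cells.

(** * The limit set *)

Section LimitSet.
Variables (R : realType) (k : nat) (D : 'I_k.+1 -> Cplx R * R).
Hypothesis hD : disjoint_geodesic_disks D.
Local Notation I := 'I_k.+1.
Local Notation rho := (reflection D).

Definition word_action (u : seq I) (x : Cplx R) : Cplx R := foldr (fun s y => rho s y) x u.

Lemma word_action_cat u v x : word_action (u ++ v) x = word_action u (word_action v x).
Proof. by rewrite /word_action foldr_cat. Qed.

Lemma word_actionK u x : word_action u (word_action (rev u) x) = x.
Proof.
elim/last_ind: u x => [|u s IH] x //=; rewrite rev_rcons -cats1 word_action_cat /=.
by rewrite reflectionK.
Qed.

Lemma Gamma_word g : Gamma D g -> exists u, g =1 word_action u.
Proof.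
elim=> [|l|g1 g2 _ [u1 e1] _ [u2 e2]|g1 g2 _ [u e] gK Kg].
- by exists [::].
- by exists [:: l].
- by exists (u1 ++ u2) => x; rewrite word_action_cat /= e2 e1.
- exists (rev u) => x; apply: (can_inj gK).
  by rewrite Kg e word_actionK.
Qed.

Lemma word_reduce u : exists2 v, reduced v & word_action u =1 word_action v.
Proof.
elim: u => [|s u [v rv e]]; first by exists [::].
case: v rv e => [|t v] rv e; first by exists [:: s] => // x /=; rewrite e.
have [st|st] := eqVneq s t.
  exists v; first exact: reduced_tail rv.
  by move=> x /=; rewrite e /= st reflectionK.
by exists (s :: t :: v) => [|x]; [rewrite /= st | rewrite /= e].
Qed.

Lemma word_action0_itinerary v : reduced v -> itinerary_set D v (word_action v 0).
Proof.
elim: v => //= s v IH rv; have {}IH := IH (reduced_tail rv).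
split; last by rewrite /= reflectionK.
case: v rv IH => [|t v] /= rv IH.
  have [D0 Dn] := primitive_normal hD s.
  apply: inversion_cdisk => //; rewrite sub0r modulusN.
  rewrite -(@ler_pXn2r _ 2) ?nnegrE ?modulus_ge0 ?(ltW D0) //.
  by rewrite Dn lerDr.
by case/andP: rv => st _; apply: (reflection_maps hD st); case: IH.
Qed.

(** Apart from 0 and its mirror images, which stay away from S^1, the orbit of 0
    lies in the finitely many cells of generation one, and these are closed. *)
Lemma limit_set_cells x : limit_set D x -> exists s t, s != t /\ itinerary_set D [:: s; t] x.
Proof.
move=> [clx Sx].
have [m m1 hm] : exists2 m, m < 1 & forall s, modulus (rho s 0) <= m.
  apply: finite_lt_bound => s; have Dn := primitive_normal hD s.
  have c1 := normal_center_gt1 Dn; have [D0 De] := Dn.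
  have -> : rho s 0 = (D s).1 * (1 - (D s).2 ^+ 2 / modulus (D s).1 ^+ 2)%:C.
    rewrite /reflection inversionE; last by apply/eqP => e; rewrite -e modulus0 ltr10 in c1.
    rewrite [0 - (D s).1]sub0r modulusN; case: (D s).1 => a b; apply/eqP; rewrite eq_complex /=.
    by apply/andP; split; apply/eqP; ring.
  rewrite modulusM modulus_real.
  have m0 : modulus (D s).1 != 0 by rewrite gt_eqF // (lt_trans ltr01).
  have -> : 1 - (D s).2 ^+ 2 / modulus (D s).1 ^+ 2 = (modulus (D s).1)^-2.
    have -> : (D s).2 ^+ 2 = modulus (D s).1 ^+ 2 - 1 by rewrite De; ring.
    by field.
  rewrite ger0_norm ?invr_ge0 ?sqr_ge0 // expr2 invfM mulrA divff // mul1r.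
  by rewrite invf_lt1 // (lt_trans ltr01).
pose m' := Num.max 0 m.
pose G := cdisk ((0 : Cplx R), m') `|`
  \bigcup_(st in [set st : I * I | st.1 != st.2]) itinerary_set D [:: st.1; st.2].
have clG : closed G.
  apply: closedU; first exact: cdisk_closed.
  apply: closed_bigcup => [|[s t] /= st]; first exact: finite_finset.
  have [P [_ eP _]] := @reduced_itinerary_cell _ _ _ hD s [:: t] (etrans (andbT _) st).
  by rewrite -[X in closed X]eP; exact: cdisk_closed.
have : closure G x.
  apply: closure_subset clx => y [g Gg <-].
  have [u eu] := Gamma_word Gg; have [v rv ev] := word_reduce u.
  rewrite eu ev; have hv := word_action0_itinerary rv.
  case: v rv {ev} hv => [|s [|t v]] rv hv.
  - by left; rewrite /cdisk /= subrr expr0n addr0 sqrtr0 le_max lexx.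
  - by left; rewrite /cdisk /= subr0 le_max hm orbT.
  - right; exists (s, t); first by move: rv => /= /andP[].
    exact: (@itinerary_set_catl _ _ _ [:: s; t] v).
move/(closure_id G).1: clG => <-  -[|[[s t] /= st h]]; last by exists s, t.
rewrite /cdisk /= subr0; move: Sx; rewrite S1E => -> h.
have : m' < 1 by rewrite gt_max ltr01.
by move/(le_lt_trans h); rewrite ltxx.
Qed.

End LimitSet.

(** * The transfer operator of the reflections *)

Section ReflectionSystem.
Variables (R : realType) (k : nat) (D : 'I_k.+1 -> Cplx R * R).
Hypothesis hD : disjoint_geodesic_disks D.
Local Notation I := 'I_k.+1.
Local Notation rho := (reflection D).

Lemma finite_le_bound (J : finType) (f : J -> R) : exists2 m, 0 <= m & forall i, f i <= m.
Proof.
exists (\big[Num.max/0]_i f i); first exact: bigmax_ge_id.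
by move=> i; exact: le_bigmax.
Qed.

Let D_gt0 l : 0 < (D l).2. Proof. by case: (primitive_normal hD l). Qed.

Let center_gt1 l : 1 < modulus (D l).1.
Proof. exact: normal_center_gt1 (primitive_normal hD l). Qed.

(** A uniform gap keeps the arcs outside D_i at a definite distance from it, which
    gives strict contraction. *)
Definition separated_by (gp : R) : Prop :=
  forall i l, i != l -> gp + (D i).2 + (D l).2 <= modulus ((D l).1 - (D i).1).

Lemma primitive_gap : exists2 gp, 0 < gp & separated_by gp.
Proof.
pose f (il : I * I) := if il.1 == il.2 then -1 else
  (D il.1).2 + (D il.2).2 - modulus ((D il.2).1 - (D il.1).1).
have [il|m m0 hm] := @finite_lt_bound R (I * I)%type f 0.
  rewrite /f; case: eqVneq => [_|ne]; first by rewrite oppr_lt0.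
  by rewrite subr_lt0 (subdisk_far hD ne (D_gt0 _)).
exists (- m); first by rewrite oppr_gt0.
move=> i l il; have := hm (i, l); rewrite /f /= (negbTE il); lra.
Qed.

Definition disk_arc (l : I) (x : Cplx R) : Prop := S1 R x /\ cdisk (D l) x.

(** This is - log |rho_i'| on S^1, see [circle_deriv_reflection]. *)
Definition log_contraction (i : I) (x : Cplx R) : R :=
  2 * (ln (modulus (x - (D i).1)) - ln (D i).2).

(** A Lipschitz substitute for the indicator of the complement of D_i: it makes the
    transfer operator act on Lipschitz functions on all of S^1, and agrees with the
    indicator on the arcs. *)
Definition cutoff (gp : R) (i : I) (x : Cplx R) : R :=
  Num.min 1 (Num.max 0 ((modulus (x - (D i).1) - (D i).2) / gp)).

Definition conformal_weight (gp delta : R) (i : I) (x : Cplx R) : R :=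
  cutoff gp i x * expR (- delta * log_contraction i x).

Lemma dist_center_ge i x : S1 R x -> modulus (D i).1 - 1 <= modulus (x - (D i).1).
Proof.
move=> Sx; have := modulusD (x - (D i).1) (- x); rewrite modulusN addrAC subrr add0r modulusN.
by move: Sx; rewrite S1E => ->; lra.
Qed.

Lemma dist_center_gt0 i x : S1 R x -> 0 < modulus (x - (D i).1).
Proof. by move=> Sx; apply: lt_le_trans (dist_center_ge i Sx); rewrite subr_gt0. Qed.

Lemma circle_deriv_reflection i x : S1 R x ->
  circle_deriv (rho i) x = expR (- log_contraction i x).
Proof.
move=> Sx; rewrite /reflection circle_deriv_inversion //; last exact: primitive_normal.
have x0 := dist_center_gt0 i Sx.
rewrite /log_contraction -mulrN opprB -ln_div ?posrE // expRM_natl lnK // posrE.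
exact: divr_gt0.
Qed.

Lemma powR_circle_deriv i x d : S1 R x ->
  circle_deriv (rho i) x `^ d = expR (- d * log_contraction i x).
Proof.
by move=> Sx; rewrite circle_deriv_reflection // /powR gt_eqF ?expR_gt0 // expRK mulrN mulNr.
Qed.

Lemma log_contraction_reflection i x : S1 R x ->
  log_contraction i (rho i x) = - log_contraction i x.
Proof.
move=> Sx; have x0 := dist_center_gt0 i Sx.
rewrite /log_contraction /reflection modulus_inversion_sub ln_div ?posrE ?exprn_gt0 //.
by rewrite lnXn //; ring.
Qed.

Lemma reflection_S1 i x : S1 R x -> S1 R (rho i x).
Proof. by apply: inversion_S1; exact: primitive_normal. Qed.

Lemma disk_arc_far gp i l x :
  separated_by gp ->
  i != l -> disk_arc l x -> gp + (D i).2 <= modulus (x - (D i).1).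
Proof.
move=> hgp il [_ Dx]; have := hgp i l il.
have := modulus_dist_triangle (D l).1 x (D i).1; rewrite (modulus_distC (D l).1 x).
move: Dx; rewrite /cdisk /=; lra.
Qed.

Lemma cutoff_in gp i x : 0 < gp -> cdisk (D i) x -> cutoff gp i x = 0.
Proof.
move=> gp0 Dx; rewrite /cutoff max_l ?min_r //.
by rewrite pmulr_lle0 ?invr_gt0 // subr_le0.
Qed.

Lemma cutoff_out gp i x : 0 < gp -> gp + (D i).2 <= modulus (x - (D i).1) ->
  cutoff gp i x = 1.
Proof.
move=> gp0 h; have h1 : 1 <= (modulus (x - (D i).1) - (D i).2) / gp.
  by rewrite ler_pdivlMr // mul1r lerBrDr.
by rewrite /cutoff min_l // le_max h1 orbT.
Qed.

Lemma clamp_lipschitz (u v : R) :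
  `|Num.min 1 (Num.max 0 u) - Num.min 1 (Num.max 0 v)| <= `|u - v|.
Proof.
have half (a b : R) : Num.min 1 (Num.max 0 a) - Num.min 1 (Num.max 0 b) <= `|a - b|.
  have := ler_norm (a - b); have := normr_ge0 (a - b).
  rewrite /Num.min /Num.max; case: (ltP 0 a) => ? ; case: (ltP 0 b) => ?;
  case: ltP => ?; case: ltP => ?; lra.
by rewrite ler_norml half andbT lerNl opprB distrC half.
Qed.

Lemma cutoff_lipschitz gp i : 0 < gp -> lipschitz_S1 (cutoff gp i).
Proof.
move=> gp0; exists gp^-1; first by rewrite invr_ge0 ltW.
move=> x y _ _; apply: le_trans (clamp_lipschitz _ _) _.
have gpV : 0 < gp^-1 by rewrite invr_gt0.
rewrite -mulrBl normrM (gtr0_norm gpV) [X in X <= _]mulrC ler_pM2l //.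
have := modulus_dist_triangle x y (D i).1; have := modulus_dist_triangle y x (D i).1.
rewrite (modulus_distC y x) ler_norml => h1 h2; apply/andP; split; lra.
Qed.

(** On S^1 the distance to the centre c of D_i is at least |c| - 1 > 0, and log is
    Lipschitz away from 0. *)
Lemma log_contraction_lip : exists2 Q, 0 <= Q & forall i x y, S1 R x -> S1 R y ->
  `|log_contraction i x - log_contraction i y| <= Q * modulus (x - y).
Proof.
have [q q0 hq] := finite_le_bound (fun i => (modulus (D i).1 - 1)^-1).
exists (2 * q); first by rewrite mulr_ge0.
move=> i; have half x y : S1 R x -> S1 R y ->
    log_contraction i x - log_contraction i y <= 2 * q * modulus (x - y).
  move=> Sx Sy; have x0 := dist_center_gt0 i Sx; have y0 := dist_center_gt0 i Sy.
  rewrite /log_contraction -mulrBr -mulrA ler_pM2l // opprB addrA subrK.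
  have -> : ln (modulus (x - (D i).1)) - ln (modulus (y - (D i).1)) =
      ln (modulus (x - (D i).1) / modulus (y - (D i).1)) by rewrite ln_div.
  rewrite -ler_expR lnK ?posrE ?divr_gt0 // ler_pdivrMr //.
  have tr := modulus_dist_triangle x y (D i).1.
  have h : modulus (x - y) <= q * modulus (x - y) * modulus (y - (D i).1).
    have yq : 1 <= q * modulus (y - (D i).1).
      have c1 : 0 < modulus (D i).1 - 1 by rewrite subr_gt0.
      apply: (@le_trans _ _ ((modulus (D i).1 - 1)^-1 * (modulus (D i).1 - 1))).
        by rewrite mulVf // gt_eqF.
      apply: ler_pM; rewrite ?invr_ge0 ?(ltW c1) //; last exact: dist_center_ge.
    by rewrite mulrAC ler_peMl ?modulus_ge0.
  apply: (le_trans tr); apply: le_trans (ler_wpM2r (ltW y0) (expR_ge1Dx _)); lra.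
move=> x y Sx Sy; rewrite ler_norml half // andbT lerNl opprB (modulus_distC x).
exact: half.
Qed.

Lemma expR_log_contraction_lip delta : exists2 K, 0 <= K & forall i x y, S1 R x -> S1 R y ->
  expR (- delta * log_contraction i x) <=
  expR (K * modulus (x - y)) * expR (- delta * log_contraction i y).
Proof.
have [Q Q0 hQ] := log_contraction_lip; exists (`|delta| * Q); first by rewrite mulr_ge0.
move=> i x y Sx Sy; rewrite -expRD ler_expR -lerBlDr -mulrBr.
apply: le_trans (ler_norm _) _; rewrite normrM normrN -mulrA ler_wpM2l // hQ //.
Qed.

Lemma conformal_weight_lipschitz gp delta i : 0 < gp ->
  lipschitz_S1 (conformal_weight gp delta i).
Proof.
move=> gp0; apply: lipschitz_S1_mul; first exact: cutoff_lipschitz.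
have [K K0 hK] := expR_log_contraction_lip delta.
exact: (lipschitz_S1_log_lip K0 (fun x _ => expR_ge0 _) (hK i)).
Qed.

Lemma reflection_lipschitz i : exists2 c, 0 <= c & forall x y, S1 R x -> S1 R y ->
  modulus (rho i x - rho i y) <= c * modulus (x - y).
Proof.
have c1 : 0 < modulus (D i).1 - 1 by rewrite subr_gt0.
exists ((D i).2 ^+ 2 / (modulus (D i).1 - 1) ^+ 2); first by rewrite divr_ge0 ?sqr_ge0.
move=> x y Sx Sy; have Dn := primitive_normal hD i.
rewrite /reflection modulus_inversion_dist; [|exact: S1_neq_center..].
rewrite mulrAC ler_wpM2r ?modulus_ge0 // ler_wpM2l ?sqr_ge0 //.
rewrite lef_pV2 ?posrE ?mulr_gt0 ?dist_center_gt0 ?exprn_gt0 //.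
by rewrite expr2 ler_pM ?dist_center_ge // ltW.
Qed.

Lemma transfer_lipschitz gp delta g : 0 < gp -> lipschitz_S1 g ->
  lipschitz_S1 (transfer rho (conformal_weight gp delta) g).
Proof.
move=> gp0 gl; apply: lipschitz_S1_sum => i; apply: lipschitz_S1_mul.
  exact: conformal_weight_lipschitz.
have [c c0 hc] := reflection_lipschitz i.
by apply: (lipschitz_S1_comp gl c0) => // x; exact: reflection_S1.
Qed.

Lemma log_contraction_bounds gp : 0 < gp ->
  separated_by gp ->
  exists u0 u1, [/\ 0 < u0, u0 <= u1 & forall i l x, i != l -> disk_arc l x ->
    u0 <= log_contraction i x <= u1].
Proof.
move=> gp0 hgp.
pose f i := - (2 * (ln (gp + (D i).2) - ln (D i).2)).
have [i|m m0 hm] := @finite_lt_bound R I f 0.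
  rewrite oppr_lt0 mulr_gt0 // subr_gt0 ltr_ln ?posrE ?addr_gt0 // ltrDr //.
have [M M0 hM] := finite_le_bound (fun i => 2 * (ln (1 + modulus (D i).1) - ln (D i).2)).
exists (- m), (M - m); split; first by rewrite oppr_gt0.
  by rewrite lerDr.
move=> i l x il Xx; have far := disk_arc_far hgp il Xx.
have [Sx _] := Xx; have x0 := dist_center_gt0 i Sx.
have := hm i; rewrite /f => h1; have := hM i => h2; rewrite /log_contraction.
have h3 : ln (gp + (D i).2) <= ln (modulus (x - (D i).1)) by rewrite ler_ln ?posrE ?addr_gt0.
have h4 : ln (modulus (x - (D i).1)) <= ln (1 + modulus (D i).1).
  rewrite ler_ln ?posrE ?ltr_wpDr ?modulus_ge0 //.
  by apply: le_trans (modulusD _ _) _; rewrite modulusN; move: Sx; rewrite S1E => ->.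
apply/andP; split; lra.
Qed.

(** |rho_i x - rho_i y| = r^2 |x - y| / (|x - c| |y - c|), and both distances to the
    centre c are at least r + gp. *)
Lemma reflection_contraction gp : 0 < gp -> separated_by gp ->
  exists theta, [/\ 0 <= theta, theta < 1 &
    forall i l x y, i != l -> disk_arc l x -> disk_arc l y ->
    modulus (rho i x - rho i y) <= theta * modulus (x - y)].
Proof.
move=> gp0 hgp.
have [i|m m1 hm] := @finite_lt_bound R I (fun i => ((D i).2 / (gp + (D i).2)) ^+ 2) 1.
  rewrite -[ltRHS](expr1n _ 2) ltr_pXn2r ?nnegrE ?divr_ge0 ?ltW ?addr_gt0 //.
  by rewrite ltr_pdivrMr ?addr_gt0 // mul1r ltrDr.
exists m; split=> //; first by apply: le_trans (hm ord0); exact: sqr_ge0.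
move=> i l x y il Xx Xy; have fx := disk_arc_far hgp il Xx; have fy := disk_arc_far hgp il Xy.
have gi : 0 < gp + (D i).2 by rewrite addr_gt0.
have Dn := primitive_normal hD i; have [Sx _] := Xx; have [Sy _] := Xy.
rewrite /reflection modulus_inversion_dist; [|exact: S1_neq_center..].
rewrite mulrAC ler_wpM2r ?modulus_ge0 //; apply: le_trans (hm i).
rewrite expr_div_n ler_wpM2l ?sqr_ge0 //.
rewrite lef_pV2 ?posrE ?mulr_gt0 ?dist_center_gt0 ?exprn_gt0 //.
by rewrite expr2 ler_pM // ltW.
Qed.

Lemma reflection_markov_system gp delta : (2 <= k)%N -> 0 < gp ->
  separated_by gp ->
  exists m M K theta, [/\ 0 <= K, 0 <= theta < 1 &
    markov_system (fun x y => modulus (x - y)) disk_arc rho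
      (conformal_weight gp delta) m M K theta].
Proof.
move=> k2 gp0 hgp.
have [K K0 hK] := expR_log_contraction_lip delta.
have [theta [t0 t1 ht]] := reflection_contraction gp0 hgp.
have [u0 [u1 [u00 u01 hu]]] := log_contraction_bounds gp0 hgp.
have w1 i l x : i != l -> disk_arc l x ->
    conformal_weight gp delta i x = expR (- delta * log_contraction i x).
  by move=> il Xx; rewrite /conformal_weight cutoff_out ?mul1r // (disk_arc_far hgp il).
exists (expR (- (`|delta| * u1))), (expR (`|delta| * u1)), K, theta.
split=> //; first by rewrite t0.
split.
- by move=> x y; exact: modulus_ge0.
- by move=> l x y [Sx _] [Sy _]; exact: S1_diam.
- by move=> l x [_ Dx]; rewrite /conformal_weight cutoff_in ?mul0r.
- exact: expR_gt0.
- move=> i l x il Xx; rewrite (w1 _ _ _ il Xx) !ler_expR.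
  have /andP[h0 h1] := hu _ _ _ il Xx.
  rewrite -ler_norml normrM normrN ler_wpM2l // ger0_norm // ltW //.
  exact: lt_le_trans h0.
- move=> i l x y il Xx Xy; rewrite (w1 _ _ _ il Xx) (w1 _ _ _ il Xy).
  by apply: hK; [case: Xx | case: Xy].
- move=> i l x il [Sx Dx]; split; first exact: reflection_S1.
  exact: (reflection_maps hD il).
- exact: ht.
- by rewrite card_ord.
Qed.

End ReflectionSystem.

(** * Invariance of the limit measure *)

Section ConformalMeasure.
Variables (R : realType) (k : nat) (D : 'I_k.+1 -> Cplx R * R).
Hypothesis hD : disjoint_geodesic_disks D.
Local Notation I := 'I_k.+1.
Local Notation rho := (reflection D).
Variables (mu : probability (borelC R) R) (delta gp : R).
Hypothesis mu0 : mu (~` limit_set D) = 0%E.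
Hypothesis conformal : forall g, Gamma D g ->
  forall f : Cplx R -> Cplx R, {within S1 R, continuous f} ->
  cintegral mu f = cintegral mu (fun z => f (g z) * (circle_deriv g z `^ delta)%:C).
Hypotheses (gp0 : 0 < gp)
  (hgp : separated_by D gp).
Local Notation L := (transfer rho (conformal_weight D gp delta)).

Lemma limit_mean_conformal i F : lipschitz_S1 F ->
  limit_mean D mu F =
  limit_mean D mu (fun x => F (rho i x) * expR (- delta * log_contraction D i x)).
Proof.
move=> Fl.
have Fl' : lipschitz_S1 (fun x => F (rho i x) * expR (- delta * log_contraction D i x)).
  apply: lipschitz_S1_mul.
    have [c c0 hc] := reflection_lipschitz hD i.
    by apply: (lipschitz_S1_comp Fl c0) => // x; exact: reflection_S1.
  have [K K0 hK] := expR_log_contraction_lip hD delta.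
  exact: (lipschitz_S1_log_lip K0 (fun x _ => expR_ge0 _) (hK i)).
rewrite -(limit_meanE mu0 Fl) -(limit_meanE mu0 Fl').
have := conformal (Gamma_gen D i) (lipschitz_S1_continuous Fl).
move=> /(congr1 (@complex.Re R)) /= ->; apply: eq_Rintegral => x; rewrite inE => Sx.
by rewrite mulr0 subr0 powR_circle_deriv.
Qed.

(** Split g over the disks and move the i-th piece by rho_i.  A limit point in D_i
    is in a cell of generation one, hence is sent by rho_i into some D_l with
    l <> i, where the i-th piece vanishes; the other limit points are sent into
    D_i.  So after the move the i-th piece carries exactly the cut-off of L. *)
Lemma limit_mean_transfer g : lipschitz_S1 g -> limit_mean D mu (L g) = limit_mean D mu g.
Proof.
move=> gl.
pose chi i x := 1 - cutoff D gp i x.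
have chil i : lipschitz_S1 (chi i).
  by apply: lipschitz_S1_sub; [exact: lipschitz_S1_const | exact: cutoff_lipschitz].
have chi_in i x : cdisk (D i) x -> chi i x = 1.
  by move=> Dx; rewrite /chi cutoff_in // subr0.
have chi_out i l x : i != l -> S1 R x -> cdisk (D l) x -> chi i x = 0.
  move=> il Sx Dx; rewrite /chi cutoff_out ?subrr // (disk_arc_far hgp il) //; split=> //.
pose F i x := chi i x * g x.
have Fl i : lipschitz_S1 (F i) by exact: lipschitz_S1_mul.
have -> : limit_mean D mu g = limit_mean D mu (fun x => \sum_i F i x).
  apply: limit_mean_eq => x Lx; have [s [t [_ [Dx _]]]] := limit_set_cells hD Lx.
  rewrite (bigD1 s) //= /F chi_in // mul1r big1 ?addr0 // => i si.
  by rewrite (chi_out _ _ _ si) ?mul0r //; case: Lx.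
rewrite [RHS]limit_mean_sum //.
rewrite (eq_bigr _ (fun i _ => limit_mean_conformal i (Fl i))).
rewrite -[RHS](limit_mean_sum mu0); last first.
  move=> i; apply: lipschitz_S1_mul.
    have [c c0 hc] := reflection_lipschitz hD i.
    by apply: (lipschitz_S1_comp (Fl i) c0) => // x; exact: reflection_S1.
  have [K K0 hK] := expR_log_contraction_lip hD delta.
  exact: (lipschitz_S1_log_lip K0 (fun x _ => expR_ge0 _) (hK i)).
apply: limit_mean_eq => x Lx; have Sx := limit_set_S1 Lx.
have [s [t [st [Dsx [Dtx _]]]]] := limit_set_cells hD Lx.
apply: eq_bigr => i _; rewrite /F /conformal_weight.
suff -> : chi i (rho i x) = cutoff D gp i x by ring.
have [->|is_] := eqVneq i s.
  by rewrite (cutoff_in gp0 Dsx) (chi_out _ _ _ st) //; exact: reflection_S1.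
rewrite chi_in; last exact: (reflection_maps hD is_ Dsx).
by rewrite (cutoff_out gp0 (disk_arc_far hgp is_ _)).
Qed.

Lemma limit_mean_invariant :
  invariant_mean (@disk_arc R k D) rho (conformal_weight D gp delta)
    (@lipschitz_S1 R) (limit_mean D mu).
Proof.
split.
- exact: lipschitz_S1_const.
- by move=> g c; exact: lipschitz_S1_subC.
- by move=> g; exact: transfer_lipschitz.
- exact: limit_mean_const.
- move=> g c gl; rewrite limit_mean_sub //; last exact: lipschitz_S1_const.
  by rewrite limit_mean_const.
- move=> f g fl gl fg; apply: limit_mean_le => // x Lx; apply: fg.
  by have [s [t [_ [Dx _]]]] := limit_set_cells hD Lx; exists s; split=> //; case: Lx.
- exact: limit_mean_transfer.
Qed.

End ConformalMeasure.

(** * Almost invariance of McMullen's measures *)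

Section AlmostInvariance.
Variables (R : realType) (k : nat) (D : 'I_k.+1 -> Cplx R * R).
Hypothesis hD : disjoint_geodesic_disks D.
Local Notation I := 'I_k.+1.
Local Notation rho := (reflection D).
Variables (gp eps d : R) (M : nat) (P : 'I_M.+1 -> Cplx R * R) (p : 'I_M.+1 -> I).
Variable w : 'cV[R]_M.+1.
Hypotheses (gp0 : 0 < gp)
  (hgp : separated_by D gp).
Hypotheses (hP : mcmullen_list D eps P) (hp : forall i, cdisk (P i) `<=` cdisk (D (p i))).
Hypotheses (d0 : 0 < d) (w0 : forall l, 0 < w l 0).
Local Notation T := (transition_matrix D P p).
Hypothesis Tw : entrywise_power T d *m w = w.
Local Notation z := (sample_point P).

Lemma sample_point_arc l : disk_arc D (p l) (z l).
Proof. by have [Pz Sz] := sample_point_in hD hP l; split=> //; exact: hp. Qed.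

(** T_ij is the inverse of |rho'| at rho(z_j), that is |rho'| at z_j, as rho is an
    involution. *)
Lemma transition_entry i j : cdisk (P j) `<=` rho (p i) @` cdisk (P i) ->
  entrywise_power T d i j = expR (- d * log_contraction D (p i) (z j)).
Proof.
move=> sub; rewrite !mxE ifT; last by apply/asboolP.
have [Sz _] := sample_point_arc j.
rewrite circle_deriv_reflection //; last exact: reflection_S1.
rewrite log_contraction_reflection // opprK -expRN.
by rewrite /powR gt_eqF ?expR_gt0 // expRK mulrN mulNr.
Qed.

Lemma transition_entry0 i j : ~ cdisk (P j) `<=` rho (p i) @` cdisk (P i) ->
  entrywise_power T d i j = 0.
Proof.
move=> nsub; rewrite !mxE ifF; last by apply/asboolP.
by rewrite powR0 // gt_eqF.
Qed.

(** In column j the disk of P_j contributes nothing, and any other disk s exactly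
    one entry; y is the sample point of the cell containing rho_s(P_j). *)
Lemma transition_column_sum (g : Cplx R -> R) (j : 'I_M.+1) (s : I) :
  exists2 y : Cplx R, s != p j -> disk_arc D s y /\ modulus (y - rho s (z j)) <= 2 * eps &
  \sum_(i | p i == s) entrywise_power T d i j * g (z i) =
  cutoff D gp s (z j) * expR (- d * log_contraction D s (z j)) * g y.
Proof.
have [zS zD] := sample_point_arc j.
have [->|sp] := eqVneq s (p j).
  exists 0 => //; rewrite cutoff_in // !mul0r big1 // => i /eqP pij.
  by rewrite transition_entry0 ?mul0r //; exact: (list_transition_diag hD hP hp pij).
have [i0 [pi0 sub uniq]] := list_transition_exists hD hP hp sp.
exists (z i0) => [_|].
  split; first by rewrite -pi0; exact: sample_point_arc.
  exact: (list_transition_dist hD hP sub).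
rewrite (cutoff_out gp0 (disk_arc_far hgp sp _)) ?mul1r //.
rewrite (bigD1 i0) ?pi0 //= big1 ?addr0 => [|i /andP[/eqP pis ii0]].
  by rewrite transition_entry ?pi0.
rewrite transition_entry0 ?mul0r // => sub'; move/eqP: ii0; apply.
by apply: uniq; rewrite -?pis.
Qed.

Lemma atomic_mean_eigen (g : Cplx R -> R) :
  atomic_mean (fun l => w l 0) z g =
  \sum_j w j 0 * \sum_s \sum_(i | p i == s) entrywise_power T d i j * g (z i).
Proof.
transitivity (\sum_i \sum_j w j 0 * (entrywise_power T d i j * g (z i))).
  apply: eq_bigr => i _; rewrite -[in LHS]Tw mxE mulr_suml.
  by apply: eq_bigr => j _; ring.
rewrite exchange_big /=; apply: eq_bigr => j _.
by rewrite -mulr_sumr (partition_big p xpredT).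
Qed.

Local Notation Lt delta := (transfer rho
  (tilted_weight (conformal_weight D gp delta) (log_contraction D) (d - delta))).

Lemma atomic_mean_almost_invariant B (delta : R) (g : Cplx R -> R) : 0 <= B ->
  log_lip_cone (fun x y => modulus (x - y)) (@disk_arc R k D) B g ->
    expR (- (B * (2 * eps))) * atomic_mean (fun l => w l 0) z (Lt delta g) <=
  atomic_mean (fun l => w l 0) z g <=
  expR (B * (2 * eps)) * atomic_mean (fun l => w l 0) z (Lt delta g).
Proof.
move=> B0 [g0 gB] ; set Lg := transfer _ _ _.
have term j s : expR (- (B * (2 * eps))) * (conformal_weight D gp delta s (z j) *
    expR (- (d - delta) * log_contraction D s (z j)) * g (rho s (z j))) <=
    \sum_(i | p i == s) entrywise_power T d i j * g (z i) <=
    expR (B * (2 * eps)) * (conformal_weight D gp delta s (z j) *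
    expR (- (d - delta) * log_contraction D s (z j)) * g (rho s (z j))).
  have [y hy ->] := transition_column_sum g j s.
  have -> : conformal_weight D gp delta s (z j) *
      expR (- (d - delta) * log_contraction D s (z j)) =
      cutoff D gp s (z j) * expR (- d * log_contraction D s (z j)).
    rewrite /conformal_weight -mulrA -expRD.
    by have -> : - delta * log_contraction D s (z j) +
      - (d - delta) * log_contraction D s (z j) = - d * log_contraction D s (z j) by ring.
  have [zS zD] := sample_point_arc j.
  have [sp|sp] := eqVneq s (p j).
    by rewrite sp cutoff_in // !mul0r !mulr0 lexx.
  have [ys yd] := hy sp.
  rewrite (cutoff_out gp0 (disk_arc_far hgp sp _)) ?mul1r //.
  have rs : disk_arc D s (rho s (z j)).
    by split; [exact: reflection_S1 | exact: (reflection_maps hD sp zD)].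
  have Bd : B * modulus (y - rho s (z j)) <= B * (2 * eps) by rewrite ler_wpM2l.
  have e0 := expR_ge0 (- d * log_contraction D s (z j)).
  set E := expR (- d * log_contraction D s (z j)) in e0 *.
  rewrite ![expR _ * (E * _)]mulrCA.
  apply/andP; split; apply: ler_wpM2l => //.
    rewrite expRN mulrC ler_pdivrMr ?expR_gt0 // mulrC.
    apply: le_trans (gB _ _ _ rs ys) _; rewrite ler_wpM2r ?(g0 _ _ ys) //.
    by rewrite ler_expR modulus_distC.
  apply: le_trans (gB _ _ _ ys rs) _; rewrite ler_wpM2r ?(g0 _ _ rs) //.
  by rewrite ler_expR.
rewrite [atomic_mean _ _ g]atomic_mean_eigen /atomic_mean.
apply/andP; split; rewrite mulr_sumr; apply: ler_sum => j _;
  rewrite mulrCA ler_wpM2l ?(ltW (w0 j)) //;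
  rewrite /Lg /transfer mulr_sumr; apply: ler_sum => s _;
  by have /andP[] := term j s.
Qed.

End AlmostInvariance.

(** * Convergence *)

(** Above 1 a Lipschitz function has a Lipschitz logarithm. *)
Lemma lipschitz_log_lip_cone (R : realType) (k : nat) (D : 'I_k.+1 -> Cplx R * R)
    (g : Cplx R -> R) : lipschitz_S1 g ->
  exists c B, 0 <= B /\
    log_lip_cone (fun x y => modulus (x - y)) (disk_arc D) B (fun x => g x - c).
Proof.
move=> gl; have [N N0 hN] := lipschitz_S1_bounded gl; have [c c0 hc] := gl.
exists (- (N + 1)), c; split=> //.
have ge1 x : S1 R x -> 1 <= g x - - (N + 1).
  by move=> Sx; have := hN x Sx; rewrite ler_norml => /andP[]; lra.
split=> [l x [Sx _]|l x y [Sx _] [Sy _]]; first exact: le_trans (ge1 x Sx).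
apply: (@le_trans _ _ ((1 + c * modulus (x - y)) * (g y - - (N + 1)))); last first.
  by rewrite ler_wpM2r ?expR_ge1Dx // (le_trans ler01) // ge1.
have h1 := hc x y Sx Sy; have h2 := ler_norm (g x - g y).
have h3 : c * modulus (x - y) <= c * modulus (x - y) * (g y - - (N + 1)).
  by rewrite ler_peMr ?ge1 // mulr_ge0 ?modulus_ge0.
rewrite mulrDl mul1r; lra.
Qed.

Lemma mcmullen_mean_lipschitz_cvg (R : realType) (k : nat) (D : 'I_k.+1 -> Cplx R * R)
    (mu : probability (borelC R) R) (mu_ : R -> probability (borelC R) R) :
  (2 <= k)%N -> disjoint_geodesic_disks D -> is_limit_measure D mu ->
  (\forall eps \near 0^'+, is_mcmullen_measure D eps (mu_ eps)) ->
  forall (g : Cplx R -> R) (eta : R), lipschitz_S1 g -> 0 < eta ->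
  \forall eps \near 0^'+,
    `|\int[mu_ eps]_(x in S1 R) g x - \int[mu]_(x in S1 R) g x| <= eta.
Proof.
move=> k2 hD [delta [_ mu0 conf]] hmu_ g eta gl eta0.
have [gp gp0 hgp] := primitive_gap hD.
have [m [M [K [theta [K0 /andP[t0 t1] ms]]]]] := reflection_markov_system hD delta k2 gp0 hgp.
have im := limit_mean_invariant hD mu0 conf gp0 hgp.
have [u0 [u1 [u00 u01 hu]]] := log_contraction_bounds hD gp0 hgp.
have [c [B1 [B10 gB1]]] := lipschitz_log_lip_cone D gl.
(* theta < sigma < 1, and B is large enough for theta * B + K <= sigma * B *)
pose sigma := (1 + theta) / 2; pose B := Num.max B1 (2 * K / (1 - theta)).
have s0 : 0 <= sigma by rewrite /sigma; lra.
have s1 : sigma < 1 by rewrite /sigma; lra.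
have B0 : 0 <= B by rewrite le_max B10.
have KB : theta * B + K <= sigma * B.
  have h : 2 * K / (1 - theta) <= B by rewrite le_max lexx orbT.
  rewrite ler_pdivrMr ?subr_gt0 // in h; rewrite /sigma; lra.
have gB : log_lip_cone (fun x y => modulus (x - y)) (disk_arc D) B (fun x => g x - c).
  by apply: log_lip_cone_weaken gB1; [exact: ms | rewrite le_max lexx].
have u001 : 0 < u0 <= u1 by rewrite u00.
have fl : lipschitz_S1 (fun x => g x - c) by exact: lipschitz_S1_subC.
have [b0 b00 hb] := atomic_mean_limit ms im B0 s0 s1 KB fl gB u001 eta0 hu.
near=> eps.
have e0 : 0 < eps by near: eps; exact: nbhs_right_gt.
have eb : eps < b0 / (2 * B + 1).
  by near: eps; apply: nbhs_right_lt; rewrite divr_gt0 // ltr_wpDl // mulr_ge0.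
have [N [P [p [d [w [hP hp [d0 _] [Tw w0 w1] nuE]]]]]] :
  is_mcmullen_measure D eps (mu_ eps) by near: eps.
have zarc l : disk_arc D (p l) (sample_point P l) := sample_point_arc hD hP hp l.
have b_lt : 0 <= B * (2 * eps) < b0.
  have B2 : 0 < 2 * B + 1 by rewrite ltr_wpDl // mulr_ge0.
  rewrite ltr_pdivlMr // in eb.
  by apply/andP; split; [rewrite mulr_ge0 // mulr_ge0 // ltW | lra].
have := hb _ (fun l => w l 0) (sample_point P) (d - delta) (B * (2 * eps))
  (fun l => ltW (w0 l)) w1 (fun l => ex_intro _ (p l) (zarc l)) b_lt.
rewrite (atomic_Rintegral (fun l => ltW (w0 l)) w1 (fun l => (zarc l).1) nuE gl).
rewrite (limit_meanE mu0 gl) limit_mean_sub //; last exact: lipschitz_S1_const.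
rewrite (limit_mean_const mu0).
have -> : atomic_mean (fun l => w l 0) (sample_point P) (fun x => g x - c) =
    \sum_l w l 0 * g (sample_point P l) - c.
  rewrite /atomic_mean; under eq_bigr do rewrite mulrBr.
  by rewrite sumrB -mulr_suml w1 mul1r.
have -> (x y : R) : x - c - (y - c) = x - y by ring.
apply => g' g'B.
exact: (atomic_mean_almost_invariant hD gp0 hgp hP hp d0 w0 Tw delta B0 g'B).
Unshelve. all: by end_near.
Qed.

Lemma mcmullen_mean_continuous_cvg (R : realType) (k : nat) (D : 'I_k.+1 -> Cplx R * R)
    (mu : probability (borelC R) R) (mu_ : R -> probability (borelC R) R) :
  (2 <= k)%N -> disjoint_geodesic_disks D -> is_limit_measure D mu ->
  (\forall eps \near 0^'+, is_mcmullen_measure D eps (mu_ eps)) ->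
  forall (f : Cplx R -> R) (eta : R), continuous_S1 f -> 0 < eta ->
  \forall eps \near 0^'+,
    `|\int[mu_ eps]_(x in S1 R) f x - \int[mu]_(x in S1 R) f x| <= eta.
Proof.
move=> k2 hD hmu hmu_ f eta fc eta0.
have e3 : 0 < eta / 3 by rewrite divr_gt0.
have [h hl fh] := lipschitz_S1_dense fc e3.
have hc := lipschitz_S1_continuous_S1 hl.
have fb := continuous_S1_bounded fc; have hbd := lipschitz_S1_bounded hl.
have close nu := Rintegral_dist_le nu (ltW e3) fc hc fb hbd fh.
near=> eps.
have h1 : `|\int[mu_ eps]_(x in S1 R) h x - \int[mu]_(x in S1 R) h x| <= eta / 3.
  by near: eps; exact: (mcmullen_mean_lipschitz_cvg k2 hD hmu hmu_ hl e3).
have := close mu; have := close (mu_ eps); move: h1; rewrite !ler_norml.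
move=> /andP[? ?] /andP[? ?] /andP[? ?]; apply/andP; split; lra.
Unshelve. all: by end_near.
Qed.

Lemma continuous_S1_Re_Im (R : realType) (f : Cplx R -> Cplx R) :
  {within S1 R, continuous f} ->
  continuous_S1 (fun z => complex.Re (f z)) /\ continuous_S1 (fun z => complex.Im (f z)).
Proof.
move=> /subspace_continuousP fc.
have h x e : S1 R x -> 0 < e -> exists2 d, 0 < d &
    forall y, S1 R y -> modulus (x - y) < d -> modulus (f x - f y) < e.
  move=> Sx e0; have /cvgrPdist_lt/(_ e%:C) := fc x Sx.
  rewrite ltcR => /(_ e0); rewrite near_withinE => /nbhs_modulusP[d d0 hd].
  by exists d => // y Sy xy; have := hd y xy Sy; rewrite norm_modulus ltcR.
have ReIm (z : Cplx R) : `|complex.Re z| <= modulus z /\ `|complex.Im z| <= modulus z.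
  by split; rewrite -(@ler_pXn2r _ 2) ?nnegrE ?modulus_ge0 // modulus_sqr real_normK
    ?num_real // ?lerDl ?lerDr sqr_ge0.
split=> x e Sx e0; have [d d0 hd] := h x e Sx e0; exists d => // y Sy xy;
  apply: le_lt_trans (hd y Sy xy).
  by have [+ _] := ReIm (f x - f y); case: (f x) (f y) => [? ?] [? ?].
by have [_ +] := ReIm (f x - f y); case: (f x) (f y) => [? ?] [? ?].
Qed.

Theorem proposition3p1 (R : realType) (k : nat) (D : 'I_k.+1 -> Cplx R * R)
    (mu : probability (borelC R) R) (mu_ : R -> probability (borelC R) R)
    (hk : (2 <= k)%N)
    (hD : disjoint_geodesic_disks D)
    (hmu : is_limit_measure D mu)
    (hmu_ : \forall eps \near 0^'+, is_mcmullen_measure D eps (mu_ eps)) :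
  weak_cvg_at_0 mu_ mu.
Proof.
move=> f /continuous_S1_Re_Im[fRe fIm].
apply/cvgrPdist_lt => e; rewrite ltcE /= => /andP[/eqP e2 e0].
have eE : e = (complex.Re e)%:C by apply/eqP; rewrite eq_complex /= e2 !eqxx.
have e3 : 0 < complex.Re e / 3 by rewrite divr_gt0.
near=> eps; rewrite norm_modulus eE ltcR.
have h1 : `|\int[mu_ eps]_(x in S1 R) complex.Re (f x) -
            \int[mu]_(x in S1 R) complex.Re (f x)| <= complex.Re e / 3.
  by near: eps; exact: (mcmullen_mean_continuous_cvg hk hD hmu hmu_ fRe e3).
have h2 : `|\int[mu_ eps]_(x in S1 R) complex.Im (f x) -
            \int[mu]_(x in S1 R) complex.Im (f x)| <= complex.Re e / 3.
  by near: eps; exact: (mcmullen_mean_continuous_cvg hk hD hmu hmu_ fIm e3).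
apply: le_lt_trans (modulus_le_ReIm _) _; rewrite /cintegral /=.
rewrite distrC in h1; rewrite distrC in h2; lra.
Unshelve. all: by end_near.
Qed.
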